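(* For all integers $1\le k\le n$, \[h_{\Delta(\widehat{\mathcal{L}}(U_{k,n}))}(x)=\sum_{i=1}^k\binom{n-i-1}{k-i}\,\underline{H}_{U_{i,n}}(x),\] with the convention $\binom{-1}{0}=1$.
   Context: $U_{k,n}$ is the uniform matroid of rank $k$ on $[n]$ (bases: all $k$-subsets). For a loopless matroid $M$ of rank $k$ on $E$, its Bergman complex $\Delta(\widehat{\mathcal{L}}(M))$ is the simplicial complex whose faces are the chains of flats $F_1\subsetneq\cdots\subsetneq F_r$ with $\varnothing\ne F_i\ne E$ (including the empty chain); it has dimension $k-2$. With $f_{i-1}$ the number of faces with $i$ elements ($f_{-1}=1$), its $f$-polynomial is $f(x)=\sum_{i=0}^{k-1}f_{i-1}x^{k-1-i}$ and its $h$-polynomial is $h_{\Delta(\widehat{\mathcal{L}}(M))}(x)=f(x-1)$. Chow ring: $\underline{\mathrm{CH}}(M)=\mathbb{Q}[x_F: F\in\mathcal{L}(M)\setminus\{\varnothing,E\}]/(I+J)$, $I$ generated by $x_{F_1}x_{F_2}$ for incomparable flats $F_1,F_2$, $J$ by $\sum_{F\ni i}x_F-\sum_{F\ni j}x_F$ for $i,j\in E$; variables of degree $1$; $\underline{H}_M(x)=\sum_j\dim_{\mathbb{Q}}\underline{\mathrm{CH}}^j(M)x^j$. *)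

(* Defs.v *)
From HB Require Import structures.
From mathcomp Require Import all_boot all_order all_algebra.
From mathcomp Require Import mpoly.

Set Implicit Arguments.
Unset Strict Implicit.
Unset Printing Implicit Defensive.

Import Order.TTheory GRing.Theory Num.Theory.
Local Open Scope ring_scope.

(* Matroids on the ground set E = [n] = 'I_n, given by their set of bases. *)

Definition matroid (n : nat) := {set {set 'I_n}}.

Definition mrank (n : nat) (M : matroid n) (A : {set 'I_n}) : nat :=
  (\max_(B in M) #|A :&: B|)%N.

Definition mrk (n : nat) (M : matroid n) : nat := mrank M [set: 'I_n].

Definition is_flat (n : nat) (M : matroid n) (F : {set 'I_n}) : bool :=
  [forall e, (e \notin F) ==> (mrank M F < mrank M (e |: F))%N].

Definition proper_flats (n : nat) (M : matroid n) : {set {set 'I_n}} :=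
  [set F | [&& is_flat M F, F != set0 & F != setT]].

Definition unif (k n : nat) : matroid n := [set B : {set 'I_n} | #|B| == k].

(* faces: chains F_1 ⊊ ... ⊊ F_r of proper nonempty flats (empty chain
   included), represented as the (totally ordered) set {F_1,...,F_r}. *)
Definition bergman_face (n : nat) (M : matroid n) (C : {set {set 'I_n}}) : bool :=
  (C \subset proper_flats M) &&
  [forall F in C, forall G in C, (F \subset G) || (G \subset F)].

(* f_{i-1} = number of faces with i elements *)
Definition bergman_f (n : nat) (M : matroid n) (i : nat) : nat :=
  #|[set C | bergman_face M C & #|C| == i]|.

Definition bergman_fpoly (n : nat) (M : matroid n) : {poly int} :=
  \sum_(i < mrk M) (bergman_f M i)%:R *: 'X^(mrk M - 1 - i).

Definition bergman_hpoly (n : nat) (M : matroid n) : {poly int} :=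
  bergman_fpoly M \Po ('X - 1).

(* Chow ring  CH(M) = Q[x_F : F proper nonempty flat] / (I + J).          *)

Definition nvar (n : nat) (M : matroid n) : nat := #|proper_flats M|.

Definition vflat (n : nat) (M : matroid n) (v : 'I_(nvar M)) : {set 'I_n} :=
  enum_val (A := mem (proper_flats M)) v.

Definition chowI (n : nat) (M : matroid n) : seq {mpoly rat[nvar M]} :=
  [seq 'X_u * 'X_v | u <- enum 'I_(nvar M),
     v <- [seq v <- enum 'I_(nvar M) |
             ~~ (vflat u \subset vflat v) && ~~ (vflat v \subset vflat u)]].

Definition chowJ (n : nat) (M : matroid n) : seq {mpoly rat[nvar M]} :=
  [seq (\sum_(v | a \in vflat v) 'X_v) - (\sum_(v | b \in vflat v) 'X_v)
     | a <- enum 'I_n, b <- enum 'I_n].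

Definition mons (N d : nat) : {set 'X_{1..N < d.+1}} :=
  [set m | mdeg (val m) == d].

Definition monseq (N d : nat) : seq 'X_{1..N} :=
  [seq val m | m <- enum (mons N d)].

Definition coefv (N d : nat) (p : {mpoly rat[N]}) : 'rV[rat]_#|mons N d| :=
  \row_(c < #|mons N d|) p@_(val (enum_val (A := mem (mons N d)) c)).

(* The degree-d part (I+J)_d of the homogeneous ideal I+J: it is spanned by
   the products  (monomial) * (generator)  of total degree d. *)
Definition ideal_part (n : nat) (M : matroid n) (d : nat) :
    {vspace 'rV[rat]_#|mons (nvar M) d|} :=
  << [seq coefv d ('X_[m] * g)
       | g <- chowI M, m <- (if (2 <= d)%N then monseq (nvar M) (d - 2) else [::])]
  ++ [seq coefv d ('X_[m] * g)
       | g <- chowJ M, m <- (if (1 <= d)%N then monseq (nvar M) (d - 1) else [::])] >>%VS.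

(* dim_Q CH^d(M) = dim Q[x]_d - dim (I+J)_d *)
Definition chow_dim (n : nat) (M : matroid n) (d : nat) : nat :=
  (#|mons (nvar M) d| - \dim (ideal_part M d))%N.

Definition binomZ (a : int) (b : nat) : nat :=
  match a with
  | Posz m => 'C(m, b)
  | Negz 0 => (b == 0%N)
  | Negz _ => 0%N
  end.

(* Main.v *)
Require Import Defs.
From HB Require Import structures.
From mathcomp Require Import all_boot all_order all_algebra all_fingroup.
From mathcomp Require Import mpoly.
From mathcomp Require Import ring zify.
Import GRing.Theory Num.Theory.

(** Both sides are computed from the polynomials [der s], where [der s] sums over flags
    ending at a fixed s-set the product of the weights x + ... + x^(d - 1), d running
    over the jumps of the flag.

    Chow side.  Put alpha = sum of the x_F with F containing a fixed element, so that
    alpha plays the role of -x_E.  For y_H = (sum of x_G with G containing H) - alpha,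
    x_F y_H^r lies in the ideal as soon as H is not contained in F and |H \ F| <= r.
    Since y_H - x_H only involves larger flats, rewriting x_F x_H^(|H| - |F|) raises the
    weight sum |G| * exponent, so the Feichtner-Yuzvinsky monomials times powers of alpha
    span.  Their independence avoids Groebner bases:
    - for the Boolean matroid, deforming the linear relations to
      (sum over F containing a) - (sum over F containing b) = a - b
      leaves n! distinct solutions, one for each permutation, so the Chow ring has total
      dimension at least n!, which is the number of spanning monomials;
    - multiplication by alpha maps CH(U_{k,n}) to CH(U_{k+1,n}) and the spanning monomials
      of the former to spanning monomials of the latter, so the dimension formula for
      k + 1 implies the one for k.

    Bergman side.  Decomposing chains by their top gives
    h_{k+1} = (x - 1) h_k + C(n, k) A_k with A_k the Eulerian polynomial, while
    H_{k+1} = x H_k + sum_(s <= k) C(n, s) der_s; the identity follows by induction on k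
    from the hockey stick identity. *)

Set Implicit Arguments.
Unset Strict Implicit.
Unset Printing Implicit Defensive.
Local Open Scope ring_scope.

(** * Derangement and Eulerian polynomials *)

Definition qint (m : nat) : {poly int} := \sum_(i < m) 'X^i.

Lemma qintS m : qint m.+1 = 1 + 'X * qint m.
Proof.
rewrite /qint big_ord_recl expr0 mulr_sumr; congr (_ + _).
by apply: eq_bigr => i _; rewrite -exprS.
Qed.

(** The recurrence calls every smaller [t], so the recursion runs on fuel [f], immaterial once
    [s <= f]. The resulting [der s] is the derangement polynomial counting derangements by
    excedances. *)
Fixpoint derf (f s : nat) : {poly int} :=
  (s == 0%N)%:R + (if f is f'.+1 then
     \sum_(t < s) 'C(s, t)%:R * derf f' t * ('X * qint (s - t).-1) else 0).
Definition der s := derf s s.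

Lemma derfE f s : (s <= f)%N -> derf f s = der s.
Proof.
rewrite /der; elim/ltn_ind: s f => s IH f sf.
case: f sf => [|f] sf; first by have -> : s = 0%N by lia.
case: s IH sf => [|s] IH sf; first by rewrite /= !big_ord0.
rewrite /=; congr (_ + _); apply: eq_bigr => t _; have ts := ltn_ord t.
by rewrite (IH t ts f) ?(IH t ts s) //; lia.
Qed.

Lemma der_rec s : der s = (s == 0%N)%:R +
  \sum_(t < s) 'C(s, t)%:R * der t * ('X * qint (s - t).-1).
Proof.
case: s => [|s]; first by rewrite /der /= big_ord0.
rewrite {1}/der /=; congr (_ + _); apply: eq_bigr => t _.
by rewrite derfE //; have := ltn_ord t; lia.
Qed.

(** Eulerian polynomial by excedances: choose the [t] points that are not fixed, then a derangement
    of them. *)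
Definition eul s : {poly int} := \sum_(t < s.+1) 'C(s, t)%:R * der t.
Definition chowH k n : {poly int} := \sum_(s < k) 'C(n, s)%:R * der s * qint (k - s).

Lemma eul0 : eul 0 = 1.
Proof. by rewrite /eul big_ord_recl big_ord0 bin0 mul1r der_rec big_ord0 !addr0. Qed.

(** The term [t = s] of [eul s] is expanded by the recurrence for [der s]; each pair of terms then
    merges through [1 + x [m] = [m + 1]]. *)
Lemma eul_chowH s : (0 < s)%N -> eul s = chowH s s.
Proof.
move=> s0; rewrite /eul big_ord_recr /= binn mul1r der_rec.
rewrite (negPf (lt0n_neq0 s0)) add0r -big_split /=; apply: eq_bigr => t _.
have -> : (s - t = (s - t).-1.+1)%N by have := ltn_ord t; lia.
by rewrite qintS; ring.
Qed.

Lemma chowHS k n : chowH k.+1 n =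
  'X * chowH k n + \sum_(s < k.+1) 'C(n, s)%:R * der s.
Proof.
rewrite /chowH [X in _ + X]big_ord_recr [LHS]big_ord_recr /= addrA.
congr (_ + _); last by rewrite subSn // subnn qintS /qint big_ord0 mulr0 addr0 mulr1.
rewrite mulr_sumr -big_split /=; apply: eq_bigr => s _.
by rewrite subSn ?qintS; [ring|have := ltn_ord s; lia].
Qed.

(** After multiplication by [X - 1] this is the binomial expansion of [((X - 1) + 1)^m] without its
    constant term. *)
Lemma sum_bin_X1 m : \sum_(j < m) 'C(m, j)%:R * ('X - 1) ^+ (m - j).-1 = qint m.
Proof.
have nz : 'X - 1 != 0 :> {poly int} by rewrite -size_poly_eq0 -(polyC1 int) size_XsubC.
apply: (mulfI nz); rewrite /qint -subrX1.
have -> : 'X ^+ m = (('X - 1) + 1) ^+ m :> {poly int} by rewrite subrK.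
rewrite exprDn big_ord_recr /= subnn expr0 binn mul1r expr1n addrK mulr_sumr.
apply: eq_bigr => j _; rewrite expr1n mulr1 -[RHS]mulr_natl [LHS]mulrCA -exprS.
by congr (_ * _ ^+ _); have := ltn_ord j; lia.
Qed.

Lemma bin_trinomial n k s : (s <= k)%N -> (k <= n)%N ->
  ('C(n, k) * 'C(k, s) = 'C(n, s) * 'C(n - s, k - s))%N.
Proof.
move=> sk kn.
have H1 := bin_fact kn; have H2 := bin_fact sk.
have H3 := bin_fact (leq_trans sk kn).
have H4 := @bin_fact (n - s) (k - s) ltac:(lia).
have e : (n - s - (k - s) = n - k)%N by lia.
rewrite e in H4.
have p : (0 < s`! * (k - s)`! * (n - k)`!)%N by rewrite !muln_gt0 !fact_gt0.
apply/eqP; rewrite -(eqn_pmul2r p); apply/eqP; transitivity n`!.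
  by rewrite -H1 -H2; ring.
by rewrite -H3 -H4; ring.
Qed.

(** Only [t >= u] contributes. Trinomial revision pulls out [C(s, u)], and the shift [t = u + j]
    leaves [sum_bin_X1] for [s - u]. *)
Lemma sum_bin_trinomial (s u : nat) :
  \sum_(t < s) ('C(s, t) * 'C(t, u))%:R * ('X - 1) ^+ (s - t).-1 =
  'C(s, u)%:R * qint (s - u).
Proof.
have [su|us] := leqP s u.
  have -> : (s - u = 0)%N by lia.
  rewrite /qint big_ord0 mulr0 big1 // => t _.
  by rewrite [X in (_ * X)%N]bin_small ?muln0 ?mul0r //; have := ltn_ord t; lia.
rewrite -sum_bin_X1 mulr_sumr -!(big_mkord xpredT (fun t => ('C(s, t) * 'C(t, u))%:R * ('X - 1) ^+ (s - t).-1)).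
rewrite (big_cat_nat (n := u)) //=; last by lia.
rewrite big_nat_cond big1 ?add0r; last first.
  by move=> t; rewrite andbT => /andP[_ tu]; rewrite (bin_small tu) muln0 mul0r.
rewrite -{1}[u]add0n big_addn big_mkord; apply: eq_bigr => j _.
rewrite mulrA -natrM; congr (_%:R * _ ^+ _); last by lia.
have js := ltn_ord j.
by rewrite bin_trinomial ?addnK ?leq_addl //; lia.
Qed.

(** Expanding each [eul t] into the [der u] and exchanging sums, the coefficient of [der u] is given
    by [sum_bin_trinomial] and agrees with the one in [chowH s s]. *)
Lemma eul_rec s : (0 < s)%N ->
  eul s = \sum_(t < s) 'C(s, t)%:R * eul t * ('X - 1) ^+ (s - t).-1.
Proof.
move=> s0; rewrite eul_chowH // /chowH.
transitivity (\sum_(u < s) \sum_(t < s) ('C(s, t) * 'C(t, u))%:R * ('X - 1) ^+ (s - t).-1 * der u).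
  by apply: eq_bigr => u _; rewrite -mulr_suml sum_bin_trinomial; ring.
rewrite exchange_big /=; apply: eq_bigr => t _.
have ts := ltn_ord t.
rewrite /eul -!(big_mkord xpredT (fun u => ('C(s, t) * 'C(t, u))%:R * ('X - 1) ^+ (s - t).-1 * der u)).
rewrite (big_cat_nat (n := t.+1)) //=.
rewrite [X in _ + X]big_nat_cond [X in _ + X]big1 ?addr0; last first.
  by move=> u; rewrite andbT => /andP[tu _]; rewrite (bin_small tu) muln0 !mul0r.
rewrite big_mkord mulr_sumr mulr_suml; apply: eq_bigr => u _.
by rewrite natrM; ring.
Qed.

(** At [x = 1] only the term [t = s - 1] of the recurrence survives, which gives the recurrence of
    the factorial. *)
Lemma eul_at1 s : (eul s).[1] = s`!%:R.
Proof.
elim: s => [|s IH]; first by rewrite eul0 hornerC.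
rewrite eul_rec // big_ord_recr /= hornerD horner_sum big1 ?add0r.
  by rewrite subSn // subnn expr0 mulr1 binSn mulr_natl hornerMn IH -mulrnA mulnC factS.
move=> t _; rewrite !hornerE subrr expr0n.
have -> : ((s.+1 - t).-1 == 0)%N = false by have := ltn_ord t; lia.
by rewrite mulr0.
Qed.

Lemma sum_hockey (n k s : nat) : (k < n)%N -> (s <= k)%N ->
  (\sum_(s <= i < k.+1) 'C(n - i - 1, k - i) = 'C(n - s, k - s))%N.
Proof.
move=> kn; move: {2}(k - s)%N (erefl (k - s)%N) => d; elim: d s => [|d IH] s e sk.
  have -> : s = k by lia.
  by rewrite big_nat1 subnn !bin0.
rewrite big_ltn ?ltnS // IH; [|lia|lia].
have e1 : ((n - s - 1).+1 = n - s)%N by lia.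
have e2 : ((k - s.+1).+1 = k - s)%N by lia.
have := binS (n - s - 1) (k - s.+1); rewrite e1 e2 => ->.
by have -> : (n - s.+1 = n - s - 1)%N by lia.
Qed.

(** Stated for any sequence with the recurrence of the Bergman side, so that it needs no complexes.
    [B i] is the increment of [chowHS] from [i] to [i + 1]. *)
Lemma chowH_conv (h : nat -> {poly int}) n : h 0%N = 0 ->
  (forall k, (k < n)%N -> h k.+1 = ('X - 1) * h k + 'C(n, k)%:R * eul k) ->
  forall k, (0 < k <= n)%N ->
  h k = \sum_(1 <= i < k.+1) (binomZ (n%:Z - i%:Z - 1) (k - i))%:R * chowH i n.
Proof.
move=> h0 hS; set B := fun i => \sum_(s < i.+1) 'C(n, s)%:R * der s.
have chowH1 : chowH 1 n = 1.
  by rewrite /chowH big_ord1 bin0 mul1r subn0 /qint big_ord1 der_rec big_ord0 expr0 !addr0 mulr1.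
have bZ i b : (i < n)%N -> binomZ (n%:Z - i%:Z - 1) b = 'C(n - i - 1, b).
  by move=> i_n; have -> : n%:Z - i%:Z - 1 = (n - i - 1)%N%:Z by lia.
elim=> [//|[|k] IH] kn.
  rewrite big_nat1 hS // h0 mulr0 add0r bin0 mul1r eul0 chowH1 subnn mulr1.
  case: (ltnP 1 n) => n1; first by rewrite bZ // bin0.
  (* Here [n = 1], where the convention for the binomial of -1 over 0 applies. *)
  by have -> : n%:Z - 1%:Z - 1 = Negz 0 by lia.
rewrite hS ?IH; [|lia|lia].
set S := \sum_(1 <= i < _) _.
have chS : 'X * S + 'C(n, k.+1)%:R * eul k.+1 = \sum_(1 <= i < k.+3) 'C(n - i, k.+2 - i)%:R * chowH i n.
  (* The index 0 is harmless because [chowH 0 n] is an empty sum; it is needed since [B 0] is not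
     zero. *)
  have -> : S = \sum_(0 <= i < k.+2) 'C(n - i - 1, k.+1 - i)%:R * chowH i n.
    rewrite [RHS]big_ltn // [X in _ = _ * X + _]/chowH big_ord0 mulr0 add0r.
    by apply: eq_big_nat => i ik; rewrite bZ //; lia.
  have -> : 'C(n, k.+1)%:R * eul k.+1 = \sum_(0 <= i < k.+2) 'C(n - i - 1, k.+1 - i)%:R * B i.
    pose f i s := 'C(n - i - 1, k.+1 - i)%:R * ('C(n, s)%:R * der s) : {poly int}.
    transitivity (\sum_(0 <= i < k.+2) \sum_(0 <= s < k.+2 | (s <= i)%N) f i s); last first.
      apply: eq_big_nat => i ik; rewrite /B mulr_sumr -[RHS](big_mkord xpredT (f i)).
      rewrite (@big_nat_widen _ _ _ 0 i.+1 k.+2) //.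
    rewrite (exchange_big_dep_nat xpredT) //= /eul mulr_sumr.
    rewrite -(big_mkord xpredT (fun s => 'C(n, k.+1)%:R * ('C(k.+1, s)%:R * der s))).
    apply: eq_big_nat => s sk; rewrite -mulr_suml.
    (* For fixed [s] the coefficients add up over [i] by the hockey stick identity. *)
    have -> : \sum_(0 <= i < k.+2 | (s <= i)%N) 'C(n - i - 1, k.+1 - i)%:R = 'C(n - s, k.+1 - s)%:R :> {poly int}.
      rewrite -sum_hockey; [|lia|lia]; rewrite natr_sum [RHS](big_nat_widenl s 0) //.
    by rewrite !mulrA -!natrM bin_trinomial; [congr (_ %:R * _); lia|lia|lia].
  rewrite mulr_sumr -big_split big_add1 /=; apply: eq_bigr => i _.
  by rewrite chowHS mulrDr mulrCA subSS subn1 -subnS.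
(* With [S] moved to the right-hand side, the terms [i < k + 2] match by Pascal's rule; the term
   [i = k + 2] has coefficient 1, by convention when [n = k + 2]. *)
apply/eqP; rewrite mulrBl mul1r addrAC subr_eq chS; apply/eqP.
rewrite [LHS]big_nat_recr //= [in RHS]big_nat_recr //= addrAC; congr (_ + _).
  rewrite -big_split /=; apply: eq_big_nat => i ik.
  rewrite !bZ; [|lia|lia]; rewrite -mulrDl -natrD; congr (_%:R * _).
  have e1 : ((n - i - 1).+1 = n - i)%N by lia.
  have e2 : ((k.+1 - i).+1 = k.+2 - i)%N by lia.
  by have := binS (n - i - 1) (k.+1 - i); rewrite e1 e2 => ->.
rewrite subnn bin0; case: (ltnP k.+2 n) => kn'; first by rewrite bZ // bin0.
by have -> : n%:Z - k.+2%:Z - 1 = Negz 0 by lia.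
Qed.

(** * Chains of flats of uniform matroids *)

Lemma exists_set_between (T : finType) (A C : {set T}) m :
  A \subset C -> (#|A| <= m <= #|C|)%N ->
  exists B : {set T}, [/\ A \subset B, B \subset C & #|B| = m].
Proof.
move=> AC; elim: m => [|m IH] /andP[Am mC].
  by exists A; split=> //; lia.
have [Am'|] := leqP #|A| m; last by move=> ?; exists A; split=> //; lia.
have [|B [AB BC Bm]] := IH; first by lia.
have : (0 < #|C :\: B|)%N by rewrite cardsDS //; lia.
case/card_gt0P=> x; rewrite inE => /andP[xB xC].
exists (x |: B); split; first exact: subset_trans AB (subsetUr _ _).
  by rewrite subUset sub1set xC.
by rewrite cardsU1 xB Bm.
Qed.

Lemma mrank_unif k n (A : {set 'I_n}) : (k <= n)%N -> mrank (unif k n) A = minn #|A| k.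
Proof.
move=> kn; apply/eqP; rewrite eqn_leq /mrank; apply/andP; split.
  apply/bigmax_leqP => B; rewrite inE => /eqP <-.
  by rewrite leq_min !subset_leq_card ?subsetIl ?subsetIr.
have [B Bk le] : exists2 B : {set 'I_n}, #|B| = k & (minn #|A| k <= #|A :&: B|)%N.
  have [Ak|kA] := leqP #|A| k.
    have [||B [AB _ Bk]] := @exists_set_between _ A setT k; rewrite ?subsetT ?Ak ?cardsT ?card_ord //.
    by exists B => //; rewrite (setIidPl AB).
  have [||B [_ BA Bk]] := @exists_set_between _ set0 A k; rewrite ?sub0set ?cards0 ?(ltnW kA) //.
  by exists B => //; rewrite (setIidPr BA) Bk.
by apply: leq_trans le _; apply: (bigmax_sup B); rewrite ?inE ?Bk.
Qed.

Lemma mrk_unif k n : (k <= n)%N -> mrk (unif k n) = k.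
Proof. by move=> kn; rewrite /mrk mrank_unif // cardsT card_ord; apply/minn_idPr. Qed.

(** Adding an element to a set of size at least [k] leaves the rank at [k], so the only flat of that
    size is the ground set. *)
Lemma proper_flats_unif k n (F : {set 'I_n}) : (k <= n)%N ->
  (F \in proper_flats (unif k n)) = (0 < #|F| < k)%N.
Proof.
move=> kn; rewrite inE card_gt0 andbC -andbA; congr (_ && _).
have fl : is_flat (unif k n) F = (#|F| < k)%N || (F == setT).
  apply/forallP/orP => [flF|[Fk|/eqP->] e]; last by rewrite inE.
    have [->|/eqP FT] := eqVneq F setT; [by right|left].
    have : F \proper setT by rewrite properT; apply/eqP.
    case/properP=> _ [e _ eF]; have := flF e; rewrite eF /= !mrank_unif // cardsU1 eF /=.
    by lia.
  by apply/implyP => eF; rewrite !mrank_unif // cardsU1 eF (minn_idPl (ltnW Fk)) (minn_idPl Fk).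
rewrite fl; have [->|_] := eqVneq F setT; last by rewrite orbF.
by rewrite cardsT card_ord; apply/esym/negbTE; rewrite -leqNgt.
Qed.

Section Chains.
Variable T : finType.
Implicit Types (X F G : {set T}) (C : {set {set T}}).

Definition is_chain C := [forall F in C, forall G in C, (F \subset G) || (G \subset F)].
(** For [X = [n]] these are the proper nonempty flats of the uniform matroid of rank [k]. A general
    [X] is allowed because the recursion passes to the sets below the top member of a chain. *)
Definition low_sets X k := [set G : {set T} | (G \subset X) && (0 < #|G| < k)%N].
Definition chains X k i := [set C : {set {set T}} | [&& C \subset low_sets X k, is_chain C & #|C| == i]].

Lemma is_chainP C : reflect {in C &, forall F G, (F \subset G) || (G \subset F)} (is_chain C).
Proof.
apply: (iffP forall_inP) => [h F G FC GC|h F FC]; first by have /forall_inP := h F FC; apply.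
by apply/forall_inP => G GC; apply: h.
Qed.

Lemma chains0 X k : chains X k 0 = [set set0].
Proof.
apply/setP => C; rewrite !inE cards_eq0; apply/and3P/eqP => [[_ _ /eqP]//|->].
by split; rewrite ?sub0set //; apply/is_chainP => F G; rewrite inE.
Qed.

Lemma chains_le1 X k i : (k <= 1)%N -> chains X k i.+1 = set0.
Proof.
move=> k1; apply/setP => C; rewrite [RHS]inE; apply/negP; rewrite inE => /and3P[CX _ /eqP Ci].
have /card_gt0P[G /(subsetP CX)] : (0 < #|C|)%N by rewrite Ci.
by rewrite inE; lia.
Qed.

Lemma chain_card_inj C F G : is_chain C -> F \in C -> G \in C -> #|F| = #|G| -> F = G.
Proof.
move=> /is_chainP ch FC GC e; case/orP: (ch F G FC GC) => s; last apply/esym.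
  by apply/eqP; rewrite eqEcard s e /=.
by apply/eqP; rewrite eqEcard s e /=.
Qed.

(** A member of the maximal size [k] must be the top of the chain, so removing it leaves a chain of
    smaller subsets of [F]. *)
Lemma chains_top X k i F : (0 < k)%N -> F \subset X -> #|F| = k ->
  [set C in chains X k.+1 i.+1 | F \in C] = (fun C => F |: C) @: chains F k i.
Proof.
move=> k0 FX Fk; apply/setP => C; apply/idP/imsetP => [|[C' C'h ->]].
  rewrite !inE => /andP[/and3P[CX ch /eqP Ci] FC].
  exists (C :\ F); last by rewrite setD1K.
  rewrite inE; have := cardsD1 F C; rewrite FC Ci add1n => -[->]; rewrite eqxx andbT.
  apply/andP; split.
    apply/subsetP => G; rewrite !inE => /andP[GF GC].
    have /is_chainP/(_ F G FC GC)/orP := ch; have := subsetP CX G GC; rewrite inE.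
    move=> /and3P[GX G0 Gk] [FG|GF'].
      have e : F = G by apply/eqP; rewrite eqEcard FG Fk -ltnS.
      by rewrite e eqxx in GF.
    rewrite GF' G0 /= ltn_neqAle -ltnS Gk andbT; apply/eqP => GFk.
    by rewrite (chain_card_inj ch FC GC _) ?eqxx // in GF; rewrite Fk.
  by apply/is_chainP => G H; rewrite !inE => /andP[_ GC] /andP[_ HC]; move/is_chainP: ch; apply.
move: C'h; rewrite !inE => /and3P[C'F ch /eqP C'i].
have FC' : F \notin C'.
  by apply/negP => /(subsetP C'F); rewrite inE Fk ltnn !andbF.
rewrite cardsU1 FC' C'i add1n !eqxx /= !andbT; apply/andP; split.
  apply/subsetP => G; rewrite !inE => /orP[/eqP->|/(subsetP C'F)].
    by rewrite FX Fk k0 ltnSn.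
  rewrite inE => /and3P[GF -> Gk]; rewrite (subset_trans GF FX) /=; lia.
apply/is_chainP => G H; rewrite !inE => /orP[/eqP->|GC] /orP[/eqP->|HC].
- by rewrite subxx.
- by move/(subsetP C'F): HC; rewrite inE => /andP[->]; rewrite orbT.
- by move/(subsetP C'F): GC; rewrite inE => /andP[->].
- by move/is_chainP: ch; apply.
Qed.

Lemma card_chainsS X k i : (0 < k)%N ->
  #|chains X k.+1 i.+1| = (#|chains X k i.+1| +
    \sum_(F : {set T} | (F \subset X) && (#|F| == k)) #|chains F k i|)%N.
Proof.
move=> k0; pose B := [set C : {set {set T}} | [exists F in C, #|F| == k]].
rewrite -(cardsID B) addnC; congr (_ + _)%N.
  apply: eq_card => C; rewrite !inE; apply/idP/idP.
    move=> /andP[/existsPn nk /and3P[CX -> ->]]; rewrite !andbT.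
    apply/subsetP => G GC; have := subsetP CX G GC; have := nk G.
    by rewrite !inE GC /= => Gk /and3P[-> -> /=]; rewrite ltnS leq_eqVlt (negPf Gk).
  move=> /and3P[CX -> ->]; rewrite !andbT; apply/andP; split.
    apply/existsPn => G; apply/negP => /andP[GC /eqP Gk].
    by have := subsetP CX G GC; rewrite inE Gk ltnn !andbF.
  apply/subsetP => G /(subsetP CX); rewrite !inE => /and3P[-> -> /=]; exact: ltnW.
rewrite -sum1_card (eq_bigl (fun C => (C \in chains X k.+1 i.+1) && (C \in B))); last first.
  by move=> C; rewrite inE.
rewrite big_mkcondr /=.
(* A chain has at most one member of size [k], so the indicator of having one is a sum over the
   candidates [F]. *)
transitivity (\sum_(C in chains X k.+1 i.+1)
   \sum_(F : {set T} | (F \subset X) && (#|F| == k)) (F \in C : nat))%N.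
  apply: eq_bigr => C; rewrite !inE => /and3P[CX ch _].
  case: existsP => [[F /andP[FC Fk]]|nF].
    have FX : F \subset X by have := subsetP CX F FC; rewrite inE => /andP[].
    rewrite (bigD1 F) /= ?FC ?FX // big1 ?addn0 // => G /andP[/andP[_ Gk] GF].
    case GC: (G \in C) => //; rewrite (chain_card_inj ch FC GC _) ?eqxx // in GF.
    by rewrite (eqP Fk) (eqP Gk).
  rewrite big1 // => F /andP[_ Fk]; case FC: (F \in C) => //.
  by case: nF; exists F; rewrite FC.
rewrite exchange_big /=; apply: eq_bigr => F /andP[FX /eqP Fk].
transitivity #|[set C in chains X k.+1 i.+1 | F \in C]|.
  rewrite -sum1_card [RHS](eq_bigl (fun C => (C \in chains X k.+1 i.+1) && (F \in C))).
    by rewrite [RHS]big_mkcondr; apply: eq_bigr => C _; case: ifP.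
  by move=> C; rewrite inE.
rewrite chains_top // card_in_imset // => C C' + + e; rewrite !inE.
move=> /and3P[CF _ _] /and3P[CF' _ _].
have nF (D : {set {set T}}) : D \subset low_sets F k -> F \notin D.
  by move=> DF; apply/negP => /(subsetP DF); rewrite inE Fk ltnn !andbF.
by rewrite -(setU1K (nF _ CF)) e setU1K // nF.
Qed.
End Chains.

(** The factor [(0 < k')] excludes the empty set as top member. *)
Fixpoint nchains k s i : nat :=
  if i is i'.+1 then
    if k is k'.+1 then (nchains k' s i + (0 < k') * 'C(s, k') * nchains k' k' i')%N else 0%N
  else 1%N.

Lemma card_chains (T : finType) (X : {set T}) k i : #|chains X k i| = nchains k #|X| i.
Proof.
elim: k X i => [|k IH] X [|i] /=; rewrite ?chains0 ?cards1 //.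
  by rewrite chains_le1 // cards0.
case: (posnP k) => [->|k0]; first by rewrite chains_le1 // cards0.
rewrite card_chainsS // IH mul1n; congr (_ + _)%N.
rewrite (eq_bigr (fun=> nchains k k i)); last by move=> F /andP[_ /eqP Fk]; rewrite IH Fk.
rewrite sum_nat_const -cards_draws; congr (_ * _)%N; apply: eq_card => F.
by rewrite !inE unfold_in.
Qed.

Lemma nchains_big k s i : (0 < k)%N -> (k <= i)%N -> nchains k s i = 0%N.
Proof.
elim: k s i => [//|k IH] s [//|i] _ ki /=.
case: (posnP k) => [->|k0] /=; first by rewrite mul0n.
by rewrite !IH ?muln0 //; lia.
Qed.

(** * The h-polynomial of the Bergman complex *)

Definition bergH k s : {poly int} := \sum_(i < k) (nchains k s i)%:R * ('X - 1) ^+ (k - 1 - i).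

Lemma bergman_hpolyE k n : (k <= n)%N -> bergman_hpoly (unif k n) = bergH k n.
Proof.
move=> kn; rewrite /bergman_hpoly /bergman_fpoly mrk_unif // /bergH.
rewrite raddf_sum /=; apply: eq_bigr => i _.
rewrite comp_polyZ comp_Xn_poly -mul_polyC polyC_natr; congr (_%:R * _).
transitivity #|chains [set: 'I_n] k i|; last by rewrite card_chains cardsT card_ord.
apply: eq_card => C; rewrite !inE /bergman_face -!andbA; congr (_ && _).
by apply: eq_subset_r => F; rewrite proper_flats_unif // !inE subsetT.
Qed.

(** Chains with no member of size [k] contribute the first term. Those with one contribute the
    second, after choosing that member. *)
Lemma bergHS k s : (0 < k)%N -> bergH k.+1 s = ('X - 1) * bergH k s + 'C(s, k)%:R * bergH k k.
Proof.
move=> k0; rewrite /bergH big_ord_recl /= subn1 /= subn0.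
have XX j : (j < k)%N -> ('X - 1) ^+ (k - j) = ('X - 1) * ('X - 1) ^+ (k - 1 - j) :> {poly int}.
  by move=> jk; rewrite -exprS; congr (_ ^+ _); lia.
have hS : ('X - 1) * \sum_(i < k) (nchains k s i)%:R * ('X - 1) ^+ (k - 1 - i) =
          ('X - 1) ^+ k + \sum_(i < k) (nchains k s i.+1)%:R * ('X - 1) ^+ (k - i.+1) :> {poly int}.
  (* The extra term [i = k] vanishes for dimension reasons; splitting off [i = 0] then shifts the
     index. *)
  transitivity (\sum_(i < k.+1) (nchains k s i)%:R * ('X - 1) ^+ (k - i) : {poly int}).
    rewrite big_ord_recr /= nchains_big // mul0r addr0 mulr_sumr.
    by apply: eq_bigr => i _; rewrite XX //; ring.
  by rewrite big_ord_recl /= subn0; case: (k) => *; rewrite mul1r.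
rewrite hS mul1r -addrA; congr (_ + _).
rewrite mulr_sumr -big_split /=; apply: eq_bigr => i _; rewrite k0 mul1n natrD natrM.
by rewrite /bump add1n -subnDA add1n; ring.
Qed.

Lemma bergH1 s : bergH 1 s = 1.
Proof. by rewrite /bergH big_ord1 /= mul1r. Qed.

(** Unrolling [bergHS] in its first argument gives a sum over the size [t] of the top member, which
    is the right-hand side of [eul_rec]. *)
Lemma bergH_diag k : (0 < k)%N -> bergH k k = eul k.
Proof.
elim/ltn_ind: k => k IH k0; rewrite eul_rec //.
have unroll m s : (m <= k)%N ->
    bergH m s = \sum_(t < m) 'C(s, t)%:R * eul t * ('X - 1) ^+ (m - t).-1.
  elim: m => [|m IHm] mk; first by rewrite /bergH !big_ord0.
  case: (posnP m) => [->|m0].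
    by rewrite bergH1 big_ord1 bin0 eul0 !mul1r subn0 expr0.
  rewrite bergHS // IHm; last exact: ltnW.
  rewrite big_ord_recr /= IH // subSnn expr0 mulr1; congr (_ + _).
  rewrite mulr_sumr; apply: eq_bigr => t _.
  have -> : ((m.+1 - t).-1 = (m - t).-1.+1)%N by have := ltn_ord t; lia.
  by rewrite exprS; ring.
exact: unroll.
Qed.

Lemma bergman_chowH k n : (0 < k <= n)%N -> bergman_hpoly (unif k n) =
   \sum_(1 <= i < k.+1) (binomZ (n%:Z - i%:Z - 1) (k - i))%:R * chowH i n.
Proof.
move=> kn; rewrite bergman_hpolyE; last by case/andP: kn.
apply: (chowH_conv (h := fun k => bergH k n)) => // [|{kn}k kn].
  by rewrite /bergH big_ord0.
case: (posnP k) => [->|k0]; last by rewrite bergHS // bergH_diag.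
by rewrite bergH1 /bergH big_ord0 bin0 eul0 mulr0 add0r mulr1.
Qed.

(** * Graded pieces of the Chow ring *)

Section LinearCombinations.
Variables (R : pzRingType) (V : lmodType R).

(** Linear span of a possibly infinite family, in a module that may have infinite dimension such as
    a polynomial ring. *)
Inductive lincomb (B : V -> Prop) : V -> Prop :=
| lincomb0 : lincomb B 0
| lincomb_cons c b p : B b -> lincomb B p -> lincomb B (c *: b + p).

Lemma lincomb_gen (B : V -> Prop) b : B b -> lincomb B b.
Proof. by move=> Bb; rewrite -[b]scale1r -[_ *: b]addr0; apply/lincomb_cons/lincomb0. Qed.

Lemma lincombD B p q : lincomb B p -> lincomb B q -> lincomb B (p + q).
Proof.
by move=> + Bq; elim=> [|c b r Bb _ IH]; rewrite ?add0r // -addrA; apply: lincomb_cons.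
Qed.

Lemma lincombZ B a p : lincomb B p -> lincomb B (a *: p).
Proof.
elim=> [|c b r Bb _ IH]; first by rewrite scaler0; apply: lincomb0.
by rewrite scalerDr scalerA; apply: lincomb_cons.
Qed.

Lemma lincombN B p : lincomb B p -> lincomb B (- p).
Proof. by rewrite -scaleN1r; apply: lincombZ. Qed.

Lemma lincombB B p q : lincomb B p -> lincomb B q -> lincomb B (p - q).
Proof. by move=> ? /lincombN; apply: lincombD. Qed.

Lemma lincomb_sum B (I : Type) (r : seq I) (P : pred I) (F : I -> V) :
  (forall i, P i -> lincomb B (F i)) -> lincomb B (\sum_(i <- r | P i) F i).
Proof. by move=> BF; elim/big_ind: _ => //; [apply: lincomb0|move=> *; apply: lincombD]. Qed.

Lemma lincomb_bind (B B' : V -> Prop) p :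
  (forall b, B b -> lincomb B' b) -> lincomb B p -> lincomb B' p.
Proof.
move=> BB'; elim=> [|c b r Bb _ IH]; first exact: lincomb0.
by apply: lincombD => //; apply/lincombZ/BB'.
Qed.

Lemma lincomb_sub (B B' : V -> Prop) p :
  (forall b, B b -> B' b) -> lincomb B p -> lincomb B' p.
Proof. by move=> BB'; apply: lincomb_bind => b /BB'/lincomb_gen. Qed.

End LinearCombinations.

Lemma lincombM (R : nzRingType) (A : algType R) (B1 B2 B3 : A -> Prop) p q :
  (forall b1 b2, B1 b1 -> B2 b2 -> lincomb B3 (b1 * b2)) ->
  lincomb B1 p -> lincomb B2 q -> lincomb B3 (p * q).
Proof.
move=> B12; elim=> [|c b r Bb _ IH] Bq; first by rewrite mul0r; apply: lincomb0.
rewrite mulrDl; apply: lincombD (IH Bq); rewrite -scalerAl; apply: lincombZ.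
elim: Bq => [|c' b' r' Bb' _ IH']; first by rewrite mulr0; apply: lincomb0.
by rewrite mulrDr -scalerAr; apply: lincombD IH'; apply/lincombZ/B12.
Qed.

Section SpanInd.
Variables (K : fieldType) (V : vectType K).

Lemma span_lincomb (X : seq V) v : v \in <<X>>%VS -> lincomb (fun u => u \in X) v.
Proof.
move=> /(@coord_span _ _ _ (in_tuple X)) ->; apply: lincomb_sum => i _.
by apply/lincombZ/lincomb_gen/mem_nth.
Qed.

End SpanInd.

Lemma linear_at0 (K : pzRingType) (U V : lmodType K) (F : U -> V) : linear F -> F 0 = 0.
Proof. by move=> linF; have := linF (-1) 0 0; rewrite scaler0 addr0 scaleN1r addNr. Qed.

Lemma span_map_linear (K : fieldType) (U V : vectType K) (F : U -> V) (X : seq U) u :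
  linear F -> u \in <<X>>%VS -> F u \in <<map F X>>%VS.
Proof.
move=> linF /span_lincomb; elim=> [|c b p bX _ IH].
  by rewrite (linear_at0 linF) mem0v.
by rewrite linF rpredD // rpredZ // memv_span // map_f.
Qed.

Lemma mem_enum_ord m (i : 'I_m) : i \in enum 'I_m.
Proof. by rewrite mem_enum. Qed.

Section Graded.
Variables (n : nat) (M : matroid n).
Local Notation N := (nvar M).
Local Notation P := {mpoly rat[N]}.

Definition chow_gen (b : P) : Prop :=
  exists m g, b = 'X_[m] * g /\ (g \in chowI M \/ g \in chowJ M).
(** The whole ideal I + J, without grading: monomial multiples of the generators span it
    linearly. *)
Definition chow_ideal : P -> Prop := lincomb chow_gen.

Lemma lincomb_mpolyX (p : P) : lincomb (fun b => exists m, b = 'X_[m]) p.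
Proof.
rewrite (mpolyE p); apply: lincomb_sum => m _.
by apply/lincombZ/lincomb_gen; exists m.
Qed.

Lemma chow_idealM q p : chow_ideal p -> chow_ideal (q * p).
Proof.
apply: lincombM (lincomb_mpolyX q) => b1 b2 [m ->] [m' [g [-> gh]]].
by apply: lincomb_gen; exists (m + m')%MM, g; rewrite mpolyXD mulrA.
Qed.

Lemma chow_ideal_gen g : g \in chowI M \/ g \in chowJ M -> chow_ideal g.
Proof. by move=> gh; apply: lincomb_gen; exists 0%MM, g; rewrite mpolyX0 mul1r. Qed.

Lemma chow_ideal_incomp u v : ~~ (vflat u \subset vflat v) -> ~~ (vflat v \subset vflat u) ->
  chow_ideal ('X_u * 'X_v : P).
Proof.
move=> uv vu; apply: chow_ideal_gen; left; apply/allpairsPdep.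
exists u, v; split=> //; first exact: mem_enum_ord.
by rewrite mem_filter uv vu /=; exact: mem_enum_ord.
Qed.

Lemma chow_ideal_lin a b :
  chow_ideal ((\sum_(v | a \in vflat v) 'X_v) - (\sum_(v | b \in vflat v) 'X_v) : P).
Proof. by apply: chow_ideal_gen; right; apply/allpairsP; exists (a, b); split; try exact: mem_enum_ord. Qed.

Lemma chowI_homog g : g \in chowI M -> g \is 2.-homog.
Proof.
case/allpairsPdep => u [v [_ _ ->]]; rewrite -mpolyXD dhomogX.
by apply/eqP; rewrite /= mdegD !mdeg1.
Qed.

Lemma sumX_homog (Q : pred 'I_N) : (\sum_(v | Q v) 'X_v : P) \is 1.-homog.
Proof. by apply: rpred_sum => v _; rewrite dhomogX; apply/eqP; rewrite /= mdeg1. Qed.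

Lemma chowJ_homog g : g \in chowJ M -> g \is 1.-homog.
Proof. by case/allpairsP => -[a b] [_ _ ->]; apply: rpredB; apply: sumX_homog. Qed.

Lemma mem_monseq K d (m : 'X_{1..K}) : (m \in monseq K d) = (mdeg m == d).
Proof.
apply/mapP/eqP => [[b]|md]; first by rewrite mem_enum inE => /eqP bd ->.
have md' : (mdeg m < d.+1)%N by rewrite md.
by exists (BMultinom md'); rewrite // mem_enum inE /= md.
Qed.

Lemma coefv_is_linear d : linear (@coefv N d).
Proof. by move=> a p q; apply/rowP => c; rewrite !mxE mcoeffD mcoeffZ. Qed.

Lemma coefvD d (p q : P) : coefv d (p + q) = coefv d p + coefv d q.
Proof. by rewrite -[p]scale1r coefv_is_linear !scale1r. Qed.

Lemma coefv0 d : coefv d (0 : P) = 0.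
Proof. by apply/rowP => c; rewrite !mxE mcoeff0. Qed.

Lemma coefvZ d a (p : P) : coefv d (a *: p) = a *: coefv d p.
Proof. by rewrite -[a *: p]addr0 coefv_is_linear coefv0 addr0. Qed.

Lemma coefv_homog d e (p : P) : p \is e.-homog -> e != d -> coefv d p = 0.
Proof.
move=> ph ed; apply/rowP => c; rewrite !mxE (dhomog_nemf_coeff ph) //=.
have := enum_valP c; rewrite inE => /eqP ->; by rewrite eq_sym.
Qed.

(** Inverse of [coefv d] on homogeneous polynomials of degree [d]. *)
Definition polyv d (w : 'rV[rat]_#|mons N d|) : P :=
  \sum_c w 0 c *: 'X_[val (enum_val (A := mem (mons N d)) c)].

Lemma polyv_is_linear d : linear (@polyv d).
Proof.
move=> a p q; rewrite /polyv scaler_sumr -big_split /=.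
by apply: eq_bigr => c _; rewrite !mxE scalerDl scalerA.
Qed.

Lemma polyv_homog d (w : 'rV[rat]_#|mons N d|) : polyv w \is d.-homog.
Proof.
apply: rpred_sum => c _; apply: rpredZ; rewrite dhomogX.
by have := enum_valP c; rewrite inE.
Qed.

Lemma polyvK d (w : 'rV[rat]_#|mons N d|) : coefv d (polyv w) = w.
Proof.
apply/rowP => c; rewrite mxE raddf_sum /= (bigD1 c) //= big1 ?addr0.
  by rewrite mcoeffZ mcoeffX eqxx mulr1.
move=> c' cc'; rewrite mcoeffZ mcoeffX.
case: eqP => [/val_inj/enum_val_inj e|_]; last by rewrite mulr0.
by rewrite e eqxx in cc'.
Qed.

Lemma coefvK d (p : P) : p \is d.-homog -> polyv (coefv d p) = p.
Proof.
move=> ph; apply/mpolyP => m.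
have [md|md] := eqVneq (mdeg m) d; last first.
  by rewrite !(dhomog_nemf_coeff _ md) // polyv_homog.
have mm : m \in monseq N d by rewrite mem_monseq md.
case/mapP: mm => b; rewrite mem_enum => bm ->.
have /rowP/(_ (enum_rank_in bm b)) := polyvK (coefv d p).
by rewrite /coefv !mxE enum_rankK_in.
Qed.

(** Each monomial multiple of a generator is homogeneous, so taking the degree [d] part either kills
    it or keeps it as one of the spanning vectors. *)
Lemma coefv_ideal d p : chow_ideal p -> coefv d p \in ideal_part M d.
Proof.
elim=> [|c b q [m [g [-> gh]]] _ IH]; first by rewrite coefv0 mem0v.
rewrite coefv_is_linear rpredD // rpredZ //.
case: gh => [gI|gJ].
  have h : ('X_[m] * g) \is (mdeg m + 2).-homog.
    by apply: dhomogM (chowI_homog gI); rewrite dhomogX.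
  have [e|ne] := eqVneq (mdeg m + 2)%N d; last by rewrite (coefv_homog h ne) mem0v.
  apply: memv_span; rewrite mem_cat; apply/orP; left; apply/allpairsP; exists (g, m).
  have -> : (2 <= d)%N by lia.
  by rewrite mem_monseq; split=> //; apply/eqP; rewrite /=; lia.
have h : ('X_[m] * g) \is (mdeg m + 1).-homog.
  by apply: dhomogM (chowJ_homog gJ); rewrite dhomogX.
have [e|ne] := eqVneq (mdeg m + 1)%N d; last by rewrite (coefv_homog h ne) mem0v.
apply: memv_span; rewrite mem_cat; apply/orP; right; apply/allpairsP; exists (g, m).
have -> : (1 <= d)%N by lia.
by rewrite mem_monseq; split=> //; apply/eqP; rewrite /=; lia.
Qed.

(** The last clause keeps the degree of the cofactor of a linear generator: under the deformed
    relations such a product drops by exactly one degree. *)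
Lemma ideal_part_gen d (w : 'rV[rat]_#|mons N d|) : w \in ideal_part M d ->
  lincomb (fun u => exists m g, [/\ polyv u = 'X_[m] * g, g \in chowI M \/ g \in chowJ M &
     g \in chowI M \/ mdeg m = d.-1 /\ (0 < d)%N]) w.
Proof.
move/span_lincomb; apply: lincomb_sub => u; rewrite mem_cat => /orP[]/allpairsP[[g m]] /= [gI].
  case: (leqP 2 d) => // d2; rewrite mem_monseq => /eqP md ->.
  exists m, g; split; [|by left|by left].
  apply: coefvK; have -> : d = (mdeg m + 2)%N by lia.
  by apply: dhomogM (chowI_homog gI); rewrite dhomogX.
case: (leqP 1 d) => // d1; rewrite mem_monseq => /eqP md ->.
exists m, g; split; [|by right|by right; rewrite md subn1].
apply: coefvK; have -> : d = (mdeg m + 1)%N by lia.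
by apply: dhomogM (chowJ_homog gI); rewrite dhomogX.
Qed.

Lemma polyv_ideal d (w : 'rV[rat]_#|mons N d|) : w \in ideal_part M d -> chow_ideal (polyv w).
Proof.
move/ideal_part_gen; elim=> [|c b p [m [g [bE gh _]]] _ IH].
  by rewrite (linear_at0 (@polyv_is_linear d)); apply: lincomb0.
rewrite polyv_is_linear; apply: lincombD => //; apply/lincombZ.
by rewrite bE; apply/chow_idealM/chow_ideal_gen.
Qed.

Lemma chow_dimE d : (chow_dim M d + \dim (ideal_part M d) = #|mons N d|)%N.
Proof.
rewrite subnK //; apply: leq_trans (dimvS (subvf _)) _.
by rewrite dimvf /dim /= mul1n.
Qed.

(** Spanning criterion. The subspace [U], controlled only through its dimension, will receive the
    image of multiplication by [alpha]. *)
Lemma chow_dim_le d (U : {vspace 'rV[rat]_#|mons N d|}) (L : seq P) :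
  (forall m, mdeg m = d ->
    lincomb (fun b => [\/ b \in L, coefv d b \in U | chow_ideal b]) 'X_[m]) ->
  (chow_dim M d <= size L + \dim U)%N.
Proof.
move=> span; rewrite -(leq_add2r (\dim (ideal_part M d))) chow_dimE.
have le : (fullv <= <<map (coefv d) L>> + U + ideal_part M d)%VS.
  apply/subvP => w _; rewrite -(polyvK w) /polyv.
  rewrite (big_morph _ (@coefvD d) (coefv0 d)); apply: rpred_sum => c _.
  rewrite coefvZ rpredZ //.
  have /span : mdeg (val (enum_val (A := mem (mons N d)) c)) = d.
    by have := enum_valP c; rewrite inE => /eqP.
  elim=> [|a b p bh _ IH]; first by rewrite coefv0 mem0v.
  rewrite coefv_is_linear rpredD // rpredZ //.
  case: bh => [bL|bU|bI]; last by apply: (subvP (addvSr _ _)); apply: coefv_ideal.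
    by apply: (subvP (addvSl _ _)); apply: (subvP (addvSl _ _)); rewrite memv_span ?map_f.
  by apply: (subvP (addvSl _ _)); apply: (subvP (addvSr _ _)).
have := dimvS le; rewrite dimvf /dim /= mul1n => /leq_trans; apply.
apply: leq_trans (dimv_add_leqif _ _) _; rewrite leq_add2r.
apply: leq_trans (dimv_add_leqif _ _) _; rewrite leq_add2r.
by rewrite -(size_map (coefv d) L) dim_span.
Qed.

End Graded.

(** * Spanning monomials for uniform matroids *)

Lemma sum_by_card (T : finType) (R : pzSemiRingType) (F : {set T}) m (f : nat -> R) :
  \sum_(G : {set T} | (G \subset F) && (#|G| < m)%N) f #|G| = \sum_(t < m) 'C(#|F|, t)%:R * f t.
Proof.
transitivity (\sum_(t < m) \sum_(G : {set T} | (G \subset F) && (#|G| == t)) f #|G|).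
  rewrite (exchange_big_dep (fun G : {set T} => (G \subset F) && (#|G| < m)%N)) /=.
    apply: eq_bigr => G /andP[-> Gm]; rewrite (big_pred1 (Ordinal Gm)) // => t.
    exact: eq_sym.
  by move=> t G _ /andP[-> /eqP->] /=.
apply: eq_bigr => t _; rewrite (eq_bigr (fun=> f t)); last by move=> G /andP[_ /eqP->].
rewrite sumr_const -[LHS]mulr_natl -cards_draws; congr (_%:R * _).
by apply: eq_card => G; rewrite !inE unfold_in.
Qed.

Lemma sum_iota1 (R : nmodType) m (f : nat -> R) : \sum_(a <- iota 1 m) f a = \sum_(i < m) f i.+1.
Proof.
have -> : iota 1 m = index_iota 1 m.+1 by rewrite /index_iota subn1.
by rewrite big_add1 big_mkord.
Qed.

Section Uniform.
Variables (k n : nat) (hkn : (k <= n)%N) (a0 : 'I_n).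
Local Notation M := (unif k n).
Local Notation N := (nvar M).
Local Notation P := {mpoly rat[N]}.
Implicit Types (F G H : {set 'I_n}) (u v : 'I_N).

Lemma vflat_card v : (0 < #|vflat v| < k)%N.
Proof. by rewrite -proper_flats_unif //; exact: enum_valP. Qed.

Lemma vflat_inj : injective (@vflat n M).
Proof. exact: enum_val_inj. Qed.

Lemma vflat_ex F : (0 < #|F| < k)%N -> exists v : 'I_N, vflat v = F.
Proof.
rewrite -proper_flats_unif // => FM; exists (enum_rank_in FM F).
by rewrite /vflat enum_rankK_in.
Qed.

Definition alpha : P := \sum_(v | a0 \in vflat v) 'X_v.
(** Extends the variables to all subsets: 1 for the empty set, which starts every flag, and 0 (an
    empty sum) for nonempty sets that are not proper flats. *)
Definition xflat F : P := if F == set0 then 1 else \sum_(v | vflat v == F) 'X_v.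
Definition yset H : P := \sum_(v | H \subset vflat v) 'X_v - alpha.

Lemma xflat0 : xflat set0 = 1.
Proof. by rewrite /xflat eqxx. Qed.

Lemma xflat_vflat v : xflat (vflat v) = 'X_v.
Proof.
rewrite /xflat -cards_eq0; have := vflat_card v; case: eqP => [->//|_ _].
by rewrite (eq_bigl (fun u => u == v)) ?big_pred1_eq // => u; rewrite (inj_eq vflat_inj).
Qed.

Lemma xflat_cases F : (#|F| < k)%N -> F = set0 \/ exists2 v : 'I_N, vflat v = F & xflat F = 'X_v.
Proof.
move=> Fk; case: (posnP #|F|) => [/eqP|F0]; first by rewrite cards_eq0 => /eqP; left.
by right; have [|v vF] := @vflat_ex F; rewrite ?F0 //; exists v => //; rewrite -vF xflat_vflat.
Qed.

Lemma xflat_big F : (k <= #|F|)%N -> (0 < #|F|)%N -> xflat F = 0.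
Proof.
move=> kF F0; rewrite /xflat -cards_eq0 (negPf (lt0n_neq0 F0)) big_pred0 // => v.
by apply/eqP => vF; have := vflat_card v; rewrite vF; lia.
Qed.

Lemma chow_ideal_xflat F v : ~~ (F \subset vflat v) -> ~~ (vflat v \subset F) ->
  chow_ideal (xflat F * 'X_v).
Proof.
have [->|F0] := eqVneq F set0; first by rewrite sub0set.
rewrite -cards_eq0 -lt0n in F0; move=> Fv vF.
have [kF|Fk] := leqP k #|F|; first by rewrite xflat_big // mul0r; apply: lincomb0.
case: (xflat_cases Fk) => [F00|[u uF ->]]; first by rewrite F00 cards0 in F0.
by rewrite -uF in Fv vF; apply: chow_ideal_incomp.
Qed.

(** Pick [i] in [H] outside [F]. Modulo the linear relation for [i] and [a0], one factor [yset H]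
    becomes minus the sum of the variables of flats containing [i] but not [H]. Such a flat is
    incomparable to [F], or contains [F] and misses fewer elements of [H], so induction on [r]
    applies. *)
Lemma chow_ideal_yset r F H : ~~ (H \subset F) -> (#|H :\: F| <= r)%N ->
  chow_ideal (xflat F * yset H ^+ r).
Proof.
elim: r F => [|r IH] F HF.
  by rewrite leqn0 cards_eq0 setD_eq0 (negPf HF).
move=> cr; case/subsetPn: (HF) => i iH iF.
have -> : xflat F * yset H ^+ r.+1 =
    (xflat F * yset H ^+ r) * (\sum_(v | i \in vflat v) 'X_v - alpha) -
    \sum_(v | (i \in vflat v) && ~~ (H \subset vflat v)) (yset H ^+ r) * (xflat F * 'X_v).
  rewrite exprSr mulrA.
  have -> : \sum_(v | (i \in vflat v) && ~~ (H \subset vflat v)) (yset H ^+ r) * (xflat F * 'X_v) =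
     xflat F * yset H ^+ r * \sum_(v | (i \in vflat v) && ~~ (H \subset vflat v)) 'X_v.
    by rewrite mulr_sumr; apply: eq_bigr => v _; ring.
  rewrite -mulrBr; congr (_ * _); rewrite /yset.
  rewrite (bigID (fun v => H \subset vflat v) (fun v => i \in vflat v)) /=.
  have -> : \sum_(v | (i \in vflat v) && (H \subset vflat v)) 'X_v = \sum_(v | H \subset vflat v) 'X_v :> P.
    by apply: eq_bigl => v; apply: andb_idl => /subsetP; apply.
  by ring.
apply: lincombB; first exact/chow_idealM/chow_ideal_lin.
apply: lincomb_sum => v /andP[iv Hv].
have vF : ~~ (vflat v \subset F) by apply/subsetPn; exists i.
have [Fv|Fv] := boolP (F \subset vflat v); last exact/chow_idealM/chow_ideal_xflat.
rewrite mulrCA; apply: chow_idealM; rewrite mulrC -xflat_vflat; apply: IH => //.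
rewrite -ltnS; apply: leq_trans cr; apply: proper_card; apply/properP; split.
  by apply: setDS.
by exists i; rewrite !inE ?iv ?iF.
Qed.

(** No proper flat contains a set [H] of size [k], so [yset H] is [- alpha], and [chow_ideal_yset]
    applies to any such [H] containing [F]. *)
Lemma chow_ideal_alpha F r : (#|F| < k)%N -> (k - #|F| <= r)%N ->
  chow_ideal (xflat F * alpha ^+ r).
Proof.
move=> Fk kr; have [||H [FH _ Hk]] := @exists_set_between _ F setT k.
- exact: subsetT.
- by rewrite (ltnW Fk) cardsT card_ord.
have yH : yset H = - alpha.
  rewrite /yset big_pred0 ?add0r // => v; apply/negP => /subset_leq_card.
  by have := vflat_card v; lia.
have HF : ~~ (H \subset F) by apply/negP => /subset_leq_card; lia.
have := @chow_ideal_yset r F H HF; rewrite cardsDS // Hk => /(_ kr).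
rewrite yH exprNn mulrCA -signr_odd mulr_sign; case: odd => // /lincombN.
by rewrite opprK.
Qed.

(** * Weights of monomials *)

Definition wt (m : 'X_{1..N}) := (\sum_v m v * #|vflat v|)%N.
(* The span of the monomials of degree d and weight at least w, where x_F has weight
   |F| and alpha has weight k. *)
Definition heavy d w : P -> Prop := lincomb (fun b => exists m e,
  [/\ b = 'X_[m] * alpha ^+ e, (mdeg m + e = d)%N & (w <= wt m + k * e)%N]).

Lemma wtD m1 m2 : wt (m1 + m2)%MM = (wt m1 + wt m2)%N.
Proof. by rewrite /wt -big_split; apply: eq_bigr => v _; rewrite mnmDE mulnDl. Qed.

(** This bound makes the rewriting terminate: in a fixed degree the weight cannot grow forever. *)
Lemma wt_le m : (wt m <= k * mdeg m)%N.
Proof.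
rewrite mdegE /wt big_distrr; apply: leq_sum => v _ /=; rewrite mulnC leq_mul2r.
by have /andP[_ /ltnW ->] := vflat_card v; rewrite orbT.
Qed.

Lemma heavyM d1 w1 d2 w2 p q : heavy d1 w1 p -> heavy d2 w2 q ->
  heavy (d1 + d2) (w1 + w2) (p * q).
Proof.
apply: lincombM => b1 b2 [m1 [e1 [-> <- h1]]] [m2 [e2 [-> <- h2]]].
apply: lincomb_gen; exists (m1 + m2)%MM, (e1 + e2)%N; split.
- by rewrite mpolyXD exprD; ring.
- by rewrite mdegD; lia.
- by rewrite wtD; lia.
Qed.

Lemma heavyW d w w' p : (w' <= w)%N -> heavy d w p -> heavy d w' p.
Proof. by move=> ww; apply: lincomb_sub => b [m [e [? ? h]]]; exists m, e; split=> //; lia. Qed.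

Lemma heavyS d d' w w' p : d = d' -> (w' <= w)%N -> heavy d w p -> heavy d' w' p.
Proof. by move=> ->; apply: heavyW. Qed.

Lemma heavy1 : heavy 0 0 1.
Proof.
by apply: lincomb_gen; exists 0%MM, 0%N; split; rewrite // ?mdeg0 // mpolyX0 mul1r.
Qed.

Lemma heavyX v : heavy 1 #|vflat v| 'X_v.
Proof.
apply: lincomb_gen; exists U_(v)%MM, 0%N; split; first by rewrite mulr1.
  by rewrite mdeg1.
by rewrite /wt (bigD1 v) //= mnm1E eqxx mul1n; lia.
Qed.

Lemma heavy_alpha : heavy 1 k alpha.
Proof.
apply: lincomb_gen; exists 0%MM, 1%N; split; first by rewrite mpolyX0 mul1r.
  by rewrite mdeg0.
by lia.
Qed.

Lemma heavy_exp d w p r : heavy d w p -> heavy (d * r) (w * r) (p ^+ r).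
Proof.
move=> hp; elim: r => [|r IH]; first by rewrite !muln0 expr0; exact: heavy1.
by rewrite !mulnS exprS; exact: heavyM.
Qed.

Lemma heavy_yset H : (#|H| <= k)%N -> heavy 1 #|H| (yset H).
Proof.
move=> Hk; apply: lincombB; last exact: heavyW heavy_alpha.
by apply: lincomb_sum => v /subset_leq_card Hv; apply: heavyW (heavyX v).
Qed.

(** The difference involves only flats strictly containing [vflat v], and [alpha], whose weight [k]
    also exceeds [#|vflat v|]. *)
Lemma heavy_ysetB v : heavy 1 #|vflat v|.+1 (yset (vflat v) - 'X_v).
Proof.
rewrite /yset (bigD1 v) //=; set S := \sum_(_ | _) _.
have -> : 'X_v + S - alpha - 'X_v = S - alpha by ring.
apply: lincombB; last by apply: heavyW heavy_alpha; case/andP: (vflat_card v).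
apply: lincomb_sum => u /andP[vu uv]; apply: heavyW (heavyX u); apply: proper_card.
by rewrite properEneq vu andbT (inj_eq vflat_inj) eq_sym.
Qed.

(** In the factorization of [p^r - q^r] the factor [p - q] gains one unit of weight. *)
Lemma heavy_expB w p q r : heavy 1 w p -> heavy 1 w q -> heavy 1 w.+1 (p - q) ->
  heavy r (w * r).+1 (p ^+ r - q ^+ r).
Proof.
move=> hp hq hpq; case: r => [|r]; first by rewrite !expr0 subrr; apply: lincomb0.
rewrite subrXX mulr_sumr; apply: lincomb_sum => i _.
have := heavyM hpq (heavyM (heavy_exp (r.+1.-1 - i) hp) (heavy_exp i hq)).
by have ir := ltn_ord i; apply: heavyS; nia.
Qed.

Lemma heavy_prod (Q : pred 'I_N) (m : 'X_{1..N}) :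
  heavy (\sum_(v | Q v) m v) (\sum_(v | Q v) m v * #|vflat v|) (\prod_(v | Q v) 'X_v ^+ m v).
Proof.
elim/big_rec3: _ => [|v p w d _ IH]; first exact: heavy1.
by apply: heavyM IH; have := heavy_exp (m v) (heavyX v); rewrite mul1n mulnC.
Qed.

(* The Feichtner-Yuzvinsky monomials with largest flat F, each paired with its degree;
   f is recursion fuel, any value >= |F| giving the same list. *)
Fixpoint normalf f F : seq (nat * P) :=
  if F == set0 then [:: (0%N, 1)] else
  if f is f'.+1 then
    flatten [seq [seq ((a + p.1)%N, xflat F ^+ a * p.2) | p <- normalf f' G, a <- iota 1 (#|F| - #|G|).-1]
              | G <- enum [set G : {set 'I_n} | G \proper F]]
  else [::].
Definition normal F := normalf #|F| F.

Lemma normalfE f F : (#|F| <= f)%N -> normalf f F = normal F.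
Proof.
rewrite /normal; move: (leqnn #|F|); move: {2 4}#|F| => g.
elim: f g F => [|f IH] [|g] F Fg Ff //.
- by move: Ff; rewrite leqn0 cards_eq0 /= => ->.
- by move: Fg; rewrite leqn0 cards_eq0 /= => ->.
rewrite /=; case: eqP => // _; congr (flatten _); apply/eq_in_map => G.
by rewrite mem_enum inE => /proper_card Gc; rewrite (IH g) //; lia.
Qed.

Lemma normal0 : normal set0 = [:: (0%N, 1)].
Proof. by rewrite /normal cards0 /= eqxx. Qed.

Lemma normal_rec F : F != set0 -> normal F =
  flatten [seq [seq ((a + p.1)%N, xflat F ^+ a * p.2) | p <- normal G, a <- iota 1 (#|F| - #|G|).-1]
              | G <- enum [set G : {set 'I_n} | G \proper F]].
Proof.
move=> F0; rewrite -(@normalfE #|F|.+1) //= (negPf F0); congr (flatten _).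
apply/eq_in_map => G; rewrite mem_enum inE => /proper_card/ltnW Gc.
by rewrite normalfE.
Qed.

Lemma normal_step F G d (u : P) a : G \proper F -> (d, u) \in normal G ->
  (0 < a < #|F| - #|G|)%N -> ((a + d)%N, xflat F ^+ a * u) \in normal F.
Proof.
move=> GF du ha; have F0 : F != set0.
  by apply: contraTneq GF => ->; rewrite properE subset0 sub0set; case: eqP.
rewrite normal_rec //; apply/flattenP.
eexists; first by apply: map_f; rewrite mem_enum inE; exact: GF.
by apply/allpairsP; exists ((d, u), a); rewrite mem_iota; split=> //; move: ha => /=; lia.
Qed.

(** With [G] the next flat below [F], the exponents [1, ..., |F| - |G| - 1] of [xflat F] produce the
    weight in the recurrence of [der]. *)
Lemma gen_normal F : \sum_(p <- normal F) 'X^(p.1) = der #|F|.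
Proof.
move: {2}#|F| (leqnn #|F|) => s; elim: s F => [|s IH] F Fs.
  move: Fs; rewrite leqn0 cards_eq0 => /eqP ->.
  by rewrite normal0 big_seq1 cards0 der_rec big_ord0 addr0.
have [->|F0] := eqVneq F set0; first by rewrite normal0 big_seq1 cards0 der_rec big_ord0 addr0.
rewrite normal_rec // big_flatten big_map big_enum_cond /= der_rec cards_eq0 (negPf F0) add0r.
pose f t : {poly int} := der t * ('X * qint (#|F| - t).-1).
transitivity (\sum_(G : {set 'I_n} | (G \subset F) && (#|G| < #|F|)%N) f #|G|); last first.
  by rewrite sum_by_card; apply: eq_bigr => t _; rewrite /f mulrA.
apply: eq_big => G; first by rewrite inE andbT properEcard.
rewrite inE andbT => /proper_card Gc; rewrite big_allpairs_dep /f -IH ?mulr_suml; last by lia.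
apply: eq_bigr => p _; rewrite sum_iota1 /qint !mulr_sumr.
by apply: eq_bigr => i _; rewrite -exprS -exprD addnC.
Qed.

(** Here [alpha] acts as the variable of a top flat of rank [k], with exponent 0 allowed. *)
Definition normal_all : seq (nat * P) :=
  flatten [seq [seq ((e + p.1)%N, alpha ^+ e * p.2) | p <- normal F, e <- iota 0 (k - #|F|)]
              | F <- enum [set F : {set 'I_n} | #|F| < k]%N].

Definition normal_deg d : seq P := [seq p.2 | p <- normal_all & p.1 == d].

Lemma gen_normal_all : \sum_(p <- normal_all) 'X^(p.1) = chowH k n.
Proof.
rewrite big_flatten big_map big_enum_cond /=.
pose f t : {poly int} := der t * qint (k - t).
transitivity (\sum_(G : {set 'I_n} | (G \subset setT) && (#|G| < k)%N) f #|G|); last first.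
  rewrite sum_by_card cardsT card_ord; apply: eq_bigr => t _; rewrite /f mulrA //.
apply: eq_big => F; first by rewrite inE andbT subsetT.
rewrite big_allpairs_dep /f -gen_normal mulr_suml => _.
apply: eq_bigr => p _; rewrite /qint mulr_sumr.
have -> : iota 0 (k - #|F|) = index_iota 0 (k - #|F|) by rewrite /index_iota subn0.
by rewrite big_mkord; apply: eq_bigr => i _; rewrite -exprD addnC.
Qed.

Lemma size_normal_deg d : (size (normal_deg d))%:R = (chowH k n)`_d.
Proof.
rewrite -gen_normal_all coef_sum size_map size_filter.
elim: normal_all => [|p s IH]; first by rewrite big_nil.
by rewrite big_cons /= natrD IH coefXn eq_sym.
Qed.

Lemma mem_normal_deg F d (u : P) e : (#|F| < k)%N -> (d, u) \in normal F -> (e < k - #|F|)%N ->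
  alpha ^+ e * u \in normal_deg (e + d).
Proof.
move=> Fk du he; apply/mapP; exists ((e + d)%N, alpha ^+ e * u) => //.
rewrite mem_filter eqxx /=; apply/flattenP.
eexists; first by apply: map_f; rewrite mem_enum inE; exact: Fk.
by apply/allpairsP; exists ((d, u), e); rewrite mem_iota; split=> //; move: he => /=; lia.
Qed.

(** * Reduction of monomials to normal form *)

Section Trichotomy.
Variable m : 'X_{1..N}.
Let part s : P := \prod_(v | (#|vflat v| < s)%N) 'X_v ^+ m v.
Let deg s := (\sum_(v | (#|vflat v| < s)%N) m v)%N.
Let wgt s := (\sum_(v | (#|vflat v| < s)%N) m v * #|vflat v|)%N.

(** The variables of the monomial are absorbed by increasing size of their flats. The normal case
    also records divisibility by [xflat F], through which the next flat interacts with the part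
    already treated. *)
Lemma reduce_part s : (0 < s <= k)%N ->
  [\/ chow_ideal (part s),
      (exists2 q, heavy (deg s) (wgt s).+1 q & chow_ideal (part s - q)) |
      exists2 F : {set 'I_n}, (#|F| < s)%N & (deg s, part s) \in normal F /\ exists p, part s = p * xflat F].
Proof.
elim: s => [//|s IH] /andP[_ sk].
case: (posnP s) => [s0|s0].
  have no v : (#|vflat v| < s.+1)%N = false by rewrite s0; have := vflat_card v; lia.
  apply: Or33; exists set0; first by rewrite cards0.
  rewrite /part /deg !big_pred0 // normal0 mem_head; split=> //.
  by exists 1; rewrite xflat0 mulr1.
have {IH} := IH ltac:(lia).
have split_v v : (#|vflat v| < s.+1)%N = (#|vflat v| < s)%N || (#|vflat v| == s) by lia.
have partS : part s.+1 = part s * \prod_(v | #|vflat v| == s) 'X_v ^+ m v.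
  rewrite /part (bigID (fun v => #|vflat v| < s)%N) /=; congr (_ * _); apply: eq_bigl => v; lia.
have degS : (deg s.+1 = deg s + \sum_(v | #|vflat v| == s) m v)%N.
  rewrite /deg (bigID (fun v => #|vflat v| < s)%N) /=; congr (_ + _)%N; apply: eq_bigl => v; lia.
have wgtS : (wgt s.+1 = wgt s + \sum_(v | #|vflat v| == s) m v * #|vflat v|)%N.
  rewrite /wgt (bigID (fun v => #|vflat v| < s)%N) /=; congr (_ + _)%N; apply: eq_bigl => v; lia.
case: (pickP (fun v => (#|vflat v| == s) && (0 < m v)%N)) => [v0 /andP[/eqP v0s m0]|none]; last first.
  have m0 v : #|vflat v| == s -> m v = 0%N by move=> vs; have := none v; rewrite vs; lia.
  have -> : part s.+1 = part s by rewrite partS big1 ?mulr1 // => v /m0 ->.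
  have -> : deg s.+1 = deg s by rewrite degS big1 ?addn0 // => v /m0 ->.
  have -> : wgt s.+1 = wgt s by rewrite wgtS big1 ?addn0 // => v /m0 ->.
  case=> [h|h|[F Fs h]]; [exact: Or31|exact: Or32|apply: Or33; exists F => //; lia].
case: (pickP (fun v => [&& #|vflat v| == s, v != v0 & 0 < m v]%N)) => [v1 /and3P[/eqP v1s v10 m1] _|none].
  (* Two distinct flats of the same size are incomparable. *)
  apply: Or31; rewrite partS (bigD1 v0) ?v0s //= (bigD1 v1) ?v1s ?eqxx //=.
  case: (m v0) m0 (m v1) m1 => // a _ [//|b] _; rewrite !exprSr.
  set p1 := part s; set p2 := \prod_(_ | _) _.
  have -> : p1 * ('X_v0 ^+ a * 'X_v0 * ('X_v1 ^+ b * 'X_v1 * p2)) =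
     (p1 * 'X_v0 ^+ a * 'X_v1 ^+ b * p2) * ('X_v0 * 'X_v1) by ring.
  apply/chow_idealM/chow_ideal_incomp; apply/negP => sub; move: v10; rewrite -(inj_eq vflat_inj).
    by rewrite eq_sym eqEcard sub v0s v1s leqnn.
  by rewrite eqEcard sub v0s v1s leqnn.
have m0v v : (#|vflat v| == s) && (v != v0) -> m v = 0%N.
  by move=> /andP[vs vv]; have := none v; rewrite vs vv; lia.
have {}partS : part s.+1 = part s * 'X_v0 ^+ m v0.
  by rewrite partS (bigD1 v0) ?v0s //= big1 ?mulr1 // => v /m0v ->.
have {}degS : deg s.+1 = (deg s + m v0)%N.
  by rewrite degS (bigD1 v0) ?v0s //= big1 ?addn0 // => v /m0v ->.
have {}wgtS : wgt s.+1 = (wgt s + s * m v0)%N.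
  by rewrite wgtS (bigD1 v0) ?v0s //= big1 ?addn0 => [|v /m0v ->]; rewrite // mulnC.
have hX r : heavy r (s * r) ('X_v0 ^+ r).
  by have := heavy_exp r (heavyX v0); rewrite v0s mul1n.
case=> [h|[q hq h]|[F Fs [norm [p ep]]]].
- by apply: Or31; rewrite partS mulrC; apply: chow_idealM.
- apply: Or32; exists (q * 'X_v0 ^+ m v0); last first.
    by rewrite partS -mulrBl mulrC; apply: chow_idealM.
  by rewrite degS wgtS -addSn; apply: heavyM.
have [Fv|nFv] := boolP (F \subset vflat v0); last first.
  apply: Or31; rewrite partS ep -mulrA; apply: chow_idealM.
  case: (m v0) m0 => // a _; rewrite exprSr mulrCA; apply: chow_idealM.
  apply: chow_ideal_xflat => //; apply/negP => /subset_leq_card; rewrite v0s; lia.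
have Fp : F \proper vflat v0 by rewrite properEcard Fv v0s.
(* A small exponent extends the normal monomial by the new top flat; a large one can be
   rewritten. *)
have [ar|ra] := ltnP (m v0) (s - #|F|).
  apply: Or33; exists (vflat v0); first by rewrite v0s.
  split; last by exists (part s * 'X_v0 ^+ (m v0).-1); rewrite partS xflat_vflat -mulrA -exprSr prednK.
  rewrite degS partS addnC mulrC -xflat_vflat; apply: normal_step Fp norm _.
  by rewrite v0s m0.
set r := (s - #|F|)%N in ra.
(* Since [xflat F * yset (vflat v0) ^+ r] lies in the ideal, the factor ['X_v0 ^+ r] may be replaced
   by ['X_v0 ^+ r - yset (vflat v0) ^+ r], which is heavier. *)
apply: Or32; exists (- (part s * (yset (vflat v0) ^+ r - 'X_v0 ^+ r) * 'X_v0 ^+ (m v0 - r))).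
  apply: lincombN.
  have hy : heavy r (s * r).+1 (yset (vflat v0) ^+ r - 'X_v0 ^+ r).
    rewrite -v0s; apply: heavy_expB.
    - by apply: heavy_yset; rewrite v0s ltnW.
    - exact: heavyX.
    - exact: heavy_ysetB.
  have := heavyM (heavyM (heavy_prod (fun v => #|vflat v| < s)%N m) hy) (hX (m v0 - r)%N).
  by apply: heavyS; rewrite ?degS ?wgtS -/(deg s) -/(wgt s); nia.
rewrite opprK partS -{1}(subnK ra) exprD.
have rearrange (a b c d : P) : a * (c * b) + a * (d - b) * c = c * (a * d) by ring.
rewrite rearrange; apply: chow_idealM; rewrite ep -mulrA; apply/chow_idealM/chow_ideal_yset.
  by apply/negP => /subset_leq_card; rewrite v0s; lia.
by rewrite cardsDS // v0s.
Qed.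
End Trichotomy.

Lemma normal_spanning d w p : (0 < k)%N -> heavy d w p ->
  lincomb (fun b => b \in normal_deg d \/ chow_ideal b) p.
Proof.
move=> k0; have [t] : exists t, (k * d < w + t)%N by exists (k * d).+1; lia.
(* Induction on the gap between [w] and the maximal weight [k * d]; at gap 0 no monomial is left. *)
elim: t w p => [|t IH] w p wlt; apply: lincomb_bind => b [m [e [-> md we]]].
  by have := wt_le m; nia.
have H := reduce_part m (s := k); rewrite k0 leqnn in H; have {H} := H isT.
have all_v v : (#|vflat v| < k)%N by case/andP: (vflat_card v).
have eX : \prod_(v | (#|vflat v| < k)%N) 'X_v ^+ m v = 'X_[m] :> P.
  by rewrite mpolyXE_id; apply: eq_bigl => v; rewrite all_v.
have eD : (\sum_(v | (#|vflat v| < k)%N) m v = mdeg m)%N.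
  by rewrite mdegE; apply: eq_bigl => v; rewrite all_v.
have eW : (\sum_(v | (#|vflat v| < k)%N) m v * #|vflat v| = wt m)%N.
  by apply: eq_bigl => v; rewrite all_v.
rewrite eX eD eW; case=> [h|[q hq h]|[F Fk [nF [p' ep]]]].
- by apply: lincomb_gen; right; rewrite mulrC; apply: chow_idealM.
- rewrite -[X in lincomb _ X](subrK (q * alpha ^+ e)) -mulrBl.
  apply: lincombD.
    by apply: lincomb_gen; right; rewrite mulrC; apply: chow_idealM.
  apply: (IH w.+1); first by lia.
  by have := heavyM hq (heavy_exp e heavy_alpha); apply: heavyS; lia.
apply: lincomb_gen; have [ek|ke] := ltnP e (k - #|F|).
  by left; rewrite mulrC -md addnC; apply: mem_normal_deg nF ek.
(* A power of [alpha] too large for the top flat [F] puts the product in the ideal. *)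
by right; rewrite ep -mulrA; apply/chow_idealM/chow_ideal_alpha.
Qed.

Lemma normal_spanningX d m : (0 < k)%N -> mdeg m = d ->
  lincomb (fun b => b \in normal_deg d \/ chow_ideal b) 'X_[m].
Proof.
move=> k0 md; apply: (normal_spanning (w := 0)) => //.
by apply: lincomb_gen; exists m, 0%N; split; rewrite ?mulr1 ?addn0.
Qed.

Lemma chow_dim_le_normal d : (0 < k)%N -> (chow_dim M d <= size (normal_deg d))%N.
Proof.
move=> k0; have := @chow_dim_le n M d 0%VS (normal_deg d); rewrite dimv0 addn0; apply.
move=> m md; apply: lincomb_sub (normal_spanningX k0 md) => b [bL|bI].
  by constructor 1.
by constructor 3.
Qed.

End Uniform.

(** * The Boolean matroid *)

Lemma prod_homog (K : nat) (I : finType) (f : I -> {mpoly rat[K]}) (d : I -> nat) :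
  (forall i, f i \is (d i).-homog) -> \prod_i f i \is (\sum_i d i)%N.-homog.
Proof.
by move=> fd; elim/big_rec2: _ => [|i e p _ pe]; [exact: dhomog1|exact: dhomogM].
Qed.

Section Boolean.
Variable n' : nat.
Local Notation n := n'.+1.
Local Notation M := (unif n n).
Local Notation N := (nvar M).
Local Notation P := {mpoly rat[N]}.
Implicit Types (s t : {perm 'I_n}) (F : {set 'I_n}) (v : 'I_N).

(* A permutation s lists the ground set by position: s a is the position of a. *)
Definition initial s (i : nat) : {set 'I_n} := [set a | (s a < i)%N].
Definition label s (i : nat) : rat := (s^-1%g (inord i) : 'I_n)%:R.
Definition gap s (i : nat) : rat := label s i.-1 - label s i.
(** The solution of the deformed relations attached to [s], supported on the flag of initial sets.
    The index [i = 0] belongs to the empty set, and its gap is 0. *)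
Definition point s F : rat := \sum_(i < n | F == initial s i) gap s i.
Definition ev s (p : P) : rat := p.@[fun v => point s (vflat v)].

Lemma label_pos s a : label s (s a) = (a : nat)%:R.
Proof. by rewrite /label inord_val permK. Qed.

Lemma card_initial s i : (i <= n)%N -> #|initial s i| = i.
Proof.
move=> i_n; have -> : initial s i = s @^-1: [set j : 'I_n | (j < i)%N].
  by apply/setP => a; rewrite !inE.
rewrite card_preimset; last exact: perm_inj.
have -> : [set j : 'I_n | (j < i)%N] = widen_ord i_n @: [set: 'I_i].
  apply/setP => j; rewrite inE; apply/idP/imsetP => [ji|[x _ ->]] /=; last exact: ltn_ord.
  by exists (Ordinal ji); [rewrite inE|apply: val_inj].
by rewrite card_imset ?cardsT ?card_ord //; move=> x y /(congr1 val) /= e; apply: val_inj.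
Qed.

Lemma initial_sub s i j : (i <= j)%N -> initial s i \subset initial s j.
Proof. by move=> ij; apply/subsetP => a; rewrite !inE => /leq_trans; apply. Qed.

Lemma point_initial s (i : 'I_n) : point s (initial s i) = gap s i.
Proof.
rewrite /point (big_pred1 i) // => j.
apply/eqP/eqP => [e|->//]; apply/val_inj => /=.
by rewrite -(card_initial s (ltnW (ltn_ord j))) -e card_initial // ltnW.
Qed.

Lemma gap_neq0 s i : (0 < i < n)%N -> gap s i != 0.
Proof.
move=> hi; rewrite subr_eq0 /label eqr_nat; apply/eqP => /val_inj/perm_inj/(congr1 val) /=.
by rewrite !inordK; lia.
Qed.

Lemma point_neq0 s F : point s F != 0 -> exists i : 'I_n, F = initial s i.
Proof.
move=> nz; case: (pickP (fun i : 'I_n => F == initial s i)) => [i /eqP ->|none]; first by exists i.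
by rewrite /point big_pred0 ?eqxx in nz.
Qed.

(** The initial sets containing [a] are those with [i > s a], and their gaps telescope. *)
Lemma sum_point s a : \sum_(v : 'I_N | a \in vflat v) point s (vflat v) = (a : nat)%:R - label s n'.
Proof.
rewrite /point (exchange_big_dep xpredT) //=.
transitivity (\sum_(i < n | (s a < i)%N) gap s i).
  rewrite [RHS]big_mkcond; apply: eq_bigr => i _.
  have [i0|i0] := posnP i.
    have -> : (s a < i)%N = false by rewrite i0.
    rewrite big_pred0 // => v; apply/negP => /andP[av /eqP ve].
    by move: av; rewrite ve inE i0 ltn0.
  have [v vi] : exists v : 'I_N, vflat v = initial s i.
    by apply: (vflat_ex (leqnn n)); rewrite card_initial ?i0 ?ltn_ord // ltnW.
  case: ifPn => ai.
    rewrite (big_pred1 v) // => u; rewrite -vi (inj_eq (@vflat_inj n n)).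
    by apply: andb_idl => /eqP ->; rewrite vi inE.
  rewrite big_pred0 // => u; apply/negP => /andP[au /eqP ue].
  by move: au; rewrite ue inE (negPf ai).
rewrite -(label_pos s a) -(big_mkord (fun i => s a < i)%N (gap s)).
have sa : (s a <= n')%N by rewrite -ltnS.
rewrite (big_cat_nat (n := (s a).+1)) //= big_nat_cond big1 ?add0r; last by move=> i; lia.
rewrite big_add1 /= big_nat_cond (eq_bigl (fun i => (s a <= i < n')%N && xpredT i)); last by move=> i; lia.
rewrite -big_nat_cond; rewrite (telescope_sumr_eq (fun i => - label s i)) //; first by ring.
by move=> i _; rewrite /gap /=; ring.
Qed.

Lemma ev_lin s a b : ev s ((\sum_(v | a \in vflat v) 'X_v) - (\sum_(v | b \in vflat v) 'X_v)) =
  (a : nat)%:R - (b : nat)%:R.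
Proof.
have evs c : ev s (\sum_(v | c \in vflat v) 'X_v) = (c : nat)%:R - label s n'.
  by rewrite -sum_point /ev raddf_sum; apply: eq_bigr => v _; exact: mevalXU.
by rewrite /ev mevalB -/(ev s _) -/(ev s _) !evs; ring.
Qed.

Lemma ev_chowI s g : g \in chowI M -> ev s g = 0.
Proof.
case/allpairsPdep => u [v [_ + ->]]; rewrite mem_filter => /andP[/andP[uv vu] _].
rewrite /ev mevalM !mevalXU; apply/eqP; rewrite mulf_eq0; apply/norP => -[].
move=> /point_neq0[i ui] /point_neq0[j vj]; move: uv vu; rewrite ui vj.
by case/orP: (leq_total i j) => ij; rewrite (initial_sub s ij).
Qed.

(** Separates the points: a nonzero value at [t] forces the flags of [s] and [t] to agree. *)
Definition flagX s : P := \prod_(i < n) xflat n (initial s i).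

Lemma ev_xflat t F : (#|F| < n)%N -> F != set0 -> ev t (xflat n F) = point t F.
Proof.
move=> Fn F0; have [F00|[v vF ->]] := xflat_cases (leqnn n) Fn; first by rewrite F00 eqxx in F0.
by rewrite /ev mevalXU vF.
Qed.

Lemma ev_flagX t s : (ev t (flagX s) != 0) = (t == s).
Proof.
have cI u (i : 'I_n) : #|initial u i| = i by rewrite card_initial // ltnW.
rewrite /ev rmorph_prod /=; apply/prodf_neq0/eqP => [nz|-> i _]; last first.
  have [i0|i0] := eqVneq (initial s i) set0; first by rewrite i0 xflat0 meval1 oner_neq0.
  rewrite -/(ev s _) ev_xflat ?cI // point_initial gap_neq0 //.
  by rewrite -(cI s) card_gt0 i0 cI /=.
have eI (i : 'I_n) : initial t i = initial s i.
  have [i0|i0] := posnP i.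
    by apply/setP => a; rewrite !inE i0.
  have s0 : initial s i != set0 by rewrite -card_gt0 cI.
  have := nz i isT; rewrite /= -/(ev t _) ev_xflat ?cI // => /point_neq0[j e].
  have ij : i = j by apply: val_inj; rewrite /= -(cI s i) e cI.
  by rewrite e ij.
apply/permP => a; apply: ord_inj; apply/eqP.
rewrite eqn_leq (leqNgt (t a)) (leqNgt (s a)).
apply/andP; split; apply/negP => lt.
  have : a \in initial s (t a) by rewrite inE.
  by rewrite -eI inE ltnn.
have : a \in initial t (s a) by rewrite inE.
by rewrite eI inE ltnn.
Qed.

Lemma flagX_homog s : flagX s \is n'.-homog.
Proof.
have := @prod_homog N 'I_n (fun i => xflat n (initial s i)) (fun i => (0 < i)%N : nat).
have -> : (\sum_(i < n) (0 < i)%N = n')%N.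
  by rewrite big_ord_recl add0n (eq_bigr (fun=> 1%N)) // -(big_mkord xpredT (fun=> 1%N)) sum_nat_const_nat subn0 muln1.
apply=> i.
have [i0|i0] := posnP i.
  have -> : initial s i = set0 by apply/setP => a; rewrite !inE i0.
  by rewrite xflat0; exact: dhomog1.
have c : (#|initial s i| < n)%N by rewrite card_initial ?ltn_ord // ltnW.
have [e|[v _ ->]] := xflat_cases (leqnn n) c.
  by have := card_initial s (ltnW (ltn_ord i)); rewrite e cards0; lia.
by rewrite dhomogX /= mdeg1.
Qed.

Definition evv (p : P) : 'rV[rat]_#|{perm 'I_n}| := \row_c ev (enum_val c) p.

Lemma evv_is_linear : linear evv.
Proof. by move=> a p q; apply/rowP => c; rewrite !mxE /ev mevalD mevalZ. Qed.

(** [E] collects the evaluations at the [n!] points of complements of the graded ideal parts, which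
    have dimensions [chow_dim M d]. It contains the evaluations of all homogeneous polynomials of
    degree below [D], hence those of the [flagX s], which fill the space. *)
Lemma sum_chow_dim_ge D : (n <= D)%N -> (n`! <= \sum_(d < D) chow_dim M d)%N.
Proof.
move=> nD; pose C d := (ideal_part M d)^C%VS.
pose E := (\sum_(d < D) <<[seq evv (polyv w) | w <- vbasis (C d)]>>)%VS.
have evpL d : linear (fun w => evv (@polyv n M d w)).
  by move=> a u w; rewrite polyv_is_linear evv_is_linear.
have inE_ d (w : 'rV[rat]_#|mons N d|) : (d < D)%N -> evv (polyv w) \in E.
  elim/ltn_ind: d w => d IH w dD.
  have : w \in (ideal_part M d + C d)%VS by rewrite addv_complf memvf.
  case/memv_addP => w1 w1I [w2 w2C ->].
  rewrite -[w1 in w1 + w2]scale1r evpL scale1r rpredD //; last first.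
    apply: (subvP (sumv_sup (Ordinal dD) isT (subvv _))).
    by apply: span_map_linear; [exact: evpL | rewrite (span_basis (vbasisP _))].
  (* Multiples of incomparable products vanish at the points. A linear generator takes a constant
     value there, leaving a monomial of degree [d - 1] for the induction. *)
  elim: (ideal_part_gen w1I) => [|c b p [m [g [bE gh gd]]] _ IHp].
    by rewrite (linear_at0 (evpL d)) mem0v.
  rewrite evpL rpredD // rpredZ // bE.
  have gI0 : g \in chowI M -> evv ('X_[m] * g) \in E.
    move=> gI; have -> : evv ('X_[m] * g) = 0; last exact: mem0v.
    by apply/rowP => c'; rewrite !mxE /ev mevalM -/(ev _ g) ev_chowI // mulr0.
  case: gh => [/gI0//|/allpairsP[[x y] [_ _ /= gE]]].
  case: gd => [/gI0//|[md d0]].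
  have -> : evv ('X_[m] * g) = ((x : nat)%:R - (y : nat)%:R) *: evv 'X_[m].
    by apply/rowP => c'; rewrite !mxE /ev mevalM -/(ev _ g) gE ev_lin mulrC.
  rewrite rpredZ // -(@coefvK _ _ d.-1 'X_[m]); last by rewrite dhomogX; apply/eqP.
  by apply: IH; lia.
have E_full : (fullv <= E)%VS.
  apply/subvP => w _; rewrite (row_sum_delta w); apply: rpred_sum => c _; rewrite rpredZ //.
  pose s := enum_val c : {perm 'I_n}.
  (* [flagX s] vanishes at every point but that of [s], so rescaling gives a basis vector. *)
  have -> : delta_mx 0 c = (ev s (flagX s))^-1 *: evv (flagX s).
    apply/rowP => c'; rewrite !mxE eqxx /=; case: eqVneq => [->|ne].
      by rewrite mulVf // ev_flagX.
    have -> : ev (enum_val c') (flagX s) = 0.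
      apply/eqP/negbNE; rewrite ev_flagX; apply: contra ne => /eqP/enum_val_inj ->.
      by rewrite eqxx.
    by rewrite mulr0.
  rewrite rpredZ // -(coefvK (flagX_homog s)); apply: inE_; lia.
have := dimvS E_full; rewrite dimvf /dim /= mul1n => le_dim.
rewrite -card_Sn; apply: leq_trans le_dim _.
apply: leq_trans (dimv_leq_sum _ _ _) _; apply: leq_sum => d _.
apply: leq_trans (dim_span _) _; rewrite size_map size_tuple /C.
by rewrite dimv_compl dimvf /dim /= mul1n leq_subLR addnC chow_dimE.
Qed.
(** Setting [x = 1] in the generating function, which is Eulerian for rank [n], counts the
    monomials. *)
Lemma size_normal_all : size (normal_all n (ord0 : 'I_n)) = n`!.
Proof.
have e := congr1 (fun p : {poly int} => p.[1]) (gen_normal_all (leqnn n) (ord0 : 'I_n)).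
move: e; rewrite -eul_chowH // eul_at1 horner_sum.
rewrite (eq_bigr (fun=> 1)); last by move=> p _; rewrite hornerXn expr1n.
by rewrite big_const_seq count_predT iter_addr_0 => /eqP; rewrite eqr_nat => /eqP.
Qed.

Lemma sum_size_deg_le (A : Type) (s : seq (nat * A)) D :
  (\sum_(d < D) size [seq p.2 | p <- s & p.1 == d :> nat] <= size s)%N.
Proof.
elim: s => [|p s IH]; first by rewrite big1.
rewrite (eq_bigr (fun d : 'I_D => (p.1 == d :> nat) + size [seq p.2 | p <- s & p.1 == d :> nat])%N); last first.
  by move=> d _ /=; case: eqP.
rewrite big_split /= -[(size s).+1]add1n; apply: leq_add => //.
case: (ltnP p.1 D) => pD; last first.
  by rewrite big1 // => d _; case: eqP => // e; rewrite leqNgt e ltn_ord in pD.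
by rewrite (bigD1 (Ordinal pD)) //= eqxx big1 // => d; rewrite -val_eqE eq_sym => /negPf /= ->.
Qed.

(** Upper bounds in each degree whose total does not exceed the lower bound [n!] must all be
    equalities. [D] is large enough for that bound and for degree [d] to be counted. *)
Lemma chow_dim_boolean d : chow_dim M d = size (normal_deg n (ord0 : 'I_n) d).
Proof.
pose D := (n + d.+1)%N; have dD : (d < D)%N by rewrite /D; lia.
have le e : (chow_dim M e <= size (normal_deg n (ord0 : 'I_n) e))%N.
  exact: chow_dim_le_normal.
have ge := sum_chow_dim_ge (leq_addr d.+1 n).
have := sum_size_deg_le (normal_all n (ord0 : 'I_n)) D; rewrite size_normal_all => le'.
apply/eqP; rewrite eqn_leq le /=.
rewrite leqNgt; apply/negP => lt; have := leq_trans le' ge; rewrite leqNgt => /negP; apply.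
rewrite -/D (bigD1 (Ordinal dD)) //= [X in (_ < X)%N](bigD1 (Ordinal dD)) //=.
by rewrite -addSn leq_add // leq_sum.
Qed.
End Boolean.

(** * Truncation *)

Lemma xflat_homog k n (F : {set 'I_n}) : (k <= n)%N -> (#|F| < k)%N ->
  xflat k F \is (F != set0 : nat).-homog.
Proof.
move=> kn Fk; have [->|F0] := eqVneq F set0; first by rewrite xflat0 dhomog1.
have [e|[v _ ->]] := xflat_cases kn Fk; first by rewrite e eqxx in F0.
by rewrite dhomogX /= mdeg1.
Qed.

Lemma normal_homog k n (F : {set 'I_n}) d u : (k <= n)%N -> (#|F| < k)%N ->
  (d, u) \in normal k F -> u \is d.-homog.
Proof.
move=> kn; move: {2}#|F| (leqnn #|F|) => s; elim: s F d u => [|s IH] F d u Fs Fk.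
  move: Fs; rewrite leqn0 cards_eq0 => /eqP ->.
  by rewrite normal0 inE => /eqP[-> ->]; exact: dhomog1.
have [->|F0] := eqVneq F set0.
  by rewrite normal0 inE => /eqP[-> ->]; exact: dhomog1.
rewrite normal_rec // => /flattenP[r /mapP[G + ->]].
rewrite mem_enum inE => /proper_card GF /allpairsP[[[e w] a] /= [ew _ [-> ->]]].
apply: dhomogM; last by apply: (IH G) => //; lia.
by have := dhomogMn a (xflat_homog kn Fk); rewrite F0 mul1n.
Qed.

Lemma sum_vflat (R : nmodType) k n (Q : pred {set 'I_n}) (f : {set 'I_n} -> R) : (k <= n)%N ->
  \sum_(v : 'I_(nvar (unif k n)) | Q (vflat v)) f (vflat v) =
  \sum_(F : {set 'I_n} | (0 < #|F| < k)%N && Q F) f F.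
Proof.
move=> kn; rewrite -(big_enum_val_cond (A := mem (proper_flats (unif k n))) Q f).
by apply: eq_bigl => F; rewrite -proper_flats_unif.
Qed.

Section Truncation.
Variables (k n : nat) (hkn : (k < n)%N) (a0 : 'I_n).
Local Notation M := (unif k n).
Local Notation M' := (unif k.+1 n).
Local Notation P := {mpoly rat[nvar M]}.
Local Notation P' := {mpoly rat[nvar M']}.
Let kn : (k <= n)%N := ltnW hkn.
Implicit Types (F G : {set 'I_n}).

(** The lift of a linear relation lacks the flats of size [k]; multiplication by [alpha] repairs
    this. *)
Definition lift_flats : P -> P' := mmap (@mpolyC _ _) (fun v : 'I_(nvar M) => xflat k.+1 (vflat v)).

Lemma lift_flatsX v : lift_flats 'X_v = xflat k.+1 (vflat v).
Proof. by rewrite /lift_flats mmapX mmap1U. Qed.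

Lemma lift_flatsD p q : lift_flats (p + q) = lift_flats p + lift_flats q.
Proof. exact: rmorphD. Qed.
Lemma lift_flatsM p q : lift_flats (p * q) = lift_flats p * lift_flats q.
Proof. exact: rmorphM. Qed.
Lemma lift_flatsB p q : lift_flats (p - q) = lift_flats p - lift_flats q.
Proof. exact: rmorphB. Qed.
Lemma lift_flatsZ c p : lift_flats (c *: p) = c *: lift_flats p.
Proof. by rewrite /lift_flats mmapZ mul_mpolyC. Qed.
Lemma lift_flats_exp p i : lift_flats (p ^+ i) = lift_flats p ^+ i.
Proof. exact: rmorphXn. Qed.
Lemma lift_flats_linear : linear lift_flats.
Proof. by move=> c p q; rewrite lift_flatsD lift_flatsZ. Qed.

Lemma lift_flats_xflat F : (#|F| < k)%N -> lift_flats (xflat k F) = xflat k.+1 F.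
Proof.
move=> Fk; have [->|[v <- ->]] := xflat_cases kn Fk; last by rewrite lift_flatsX.
by rewrite !xflat0; exact: rmorph1.
Qed.

Lemma lift_flats_normal F : (#|F| < k)%N ->
  normal k.+1 F = [seq (p.1, lift_flats p.2) | p <- normal k F].
Proof.
move: {2}#|F| (leqnn #|F|) => s; elim: s F => [|s IH] F Fs Fk.
  move: Fs; rewrite leqn0 cards_eq0 => /eqP ->.
  by rewrite !normal0 /= -[lift_flats 1]/(lift_flats _) [lift_flats 1]rmorph1.
have [->|F0] := eqVneq F set0.
  by rewrite !normal0 /= [lift_flats 1]rmorph1.
rewrite !normal_rec // map_flatten -map_comp; congr (flatten _).
apply/eq_in_map => G; rewrite mem_enum inE => /proper_card GF /=.
rewrite IH; [|lia|lia]; rewrite map_allpairs allpairs_mapl.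
apply: eq_allpairs => p a; by rewrite /= lift_flatsM lift_flats_exp lift_flats_xflat.
Qed.

Lemma sum_flats_split (Q : pred {set 'I_n}) :
  \sum_(v : 'I_(nvar M') | Q (vflat v)) 'X_v =
  lift_flats (\sum_(v : 'I_(nvar M) | Q (vflat v)) 'X_v) +
  \sum_(v : 'I_(nvar M') | Q (vflat v) && (#|vflat v| == k)) 'X_v.
Proof.
rewrite (bigID (fun v : 'I_(nvar M') => #|vflat v| == k)) /= addrC; congr (_ + _).
rewrite (big_morph _ lift_flatsD (linear_at0 lift_flats_linear)).
rewrite (eq_bigr _ (fun v _ => lift_flatsX v)).
rewrite (sum_vflat Q (fun F => xflat k.+1 F) kn).
rewrite -(eq_bigr _ (fun v _ => xflat_vflat hkn v)).
rewrite (sum_vflat (fun F => Q F && (#|F| != k)) (fun F => xflat k.+1 F) hkn).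
by apply: eq_bigl => F; case: (Q F); rewrite ?andbF //= andbT; lia.
Qed.

(** In rank [k + 1] a flat of size [k] has corank 1, so the first power of [alpha] already kills
    it. *)
Lemma alpha_top (v : 'I_(nvar M')) : #|vflat v| = k -> chow_ideal (alpha k.+1 a0 * 'X_v).
Proof.
move=> vk; have := @chow_ideal_alpha k.+1 n hkn a0 (vflat v) 1.
by rewrite vk ltnSn subSnn xflat_vflat // mulrC expr1; apply.
Qed.

Lemma alpha_sum_top (Q : pred {set 'I_n}) : chow_ideal (alpha k.+1 a0 *
  \sum_(v : 'I_(nvar M') | Q (vflat v) && (#|vflat v| == k)) 'X_v).
Proof.
by rewrite mulr_sumr; apply: lincomb_sum => v /andP[_ /eqP vk]; apply: alpha_top.
Qed.

(** Lifting and multiplying by [alpha] thus descends to Chow rings: lifted linear relations differ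
    from true ones by flats of size [k], which [alpha] kills. *)
Lemma alpha_lift_ideal p : chow_ideal p -> chow_ideal (alpha k.+1 a0 * lift_flats p).
Proof.
elim=> [|c b q [m [g [-> gh]]] _ IH].
  by rewrite (linear_at0 lift_flats_linear) mulr0; apply: lincomb0.
rewrite lift_flatsD lift_flatsZ mulrDr -scalerAr; apply: lincombD IH; apply: lincombZ.
rewrite lift_flatsM mulrCA; apply: chow_idealM.
case: gh => [/allpairsPdep[u [v [_ + ->]]]|/allpairsP[[a b'] /= [_ _ ->]]].
  rewrite mem_filter => /andP[/andP[uv vu] _]; apply: chow_idealM.
  rewrite lift_flatsM !lift_flatsX.
  have vk (w : 'I_(nvar M)) : (0 < #|vflat w| < k.+1)%N by have := vflat_card kn w; lia.
  have [u' eu] := vflat_ex hkn (vk u); have [v' ev] := vflat_ex hkn (vk v).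
  by rewrite -eu -ev !xflat_vflat //; apply: chow_ideal_incomp; rewrite eu ev.
have e c' : lift_flats (\sum_(v : 'I_(nvar M) | c' \in vflat v) 'X_v) =
   \sum_(v : 'I_(nvar M') | c' \in vflat v) 'X_v -
   \sum_(v : 'I_(nvar M') | (c' \in vflat v) && (#|vflat v| == k)) 'X_v.
  by rewrite (sum_flats_split (fun F => c' \in F)) addrK.
rewrite lift_flatsB !e.
have -> (x y z t w : P') : x * (y - z - (t - w)) = x * (y - t) - x * z + x * w by ring.
apply: lincombD; [apply: lincombB|].
- exact/chow_idealM/chow_ideal_lin.
- exact: (alpha_sum_top (fun F => a \in F)).
- exact: (alpha_sum_top (fun F => b' \in F)).
Qed.

Lemma alpha_lift_exp e : chow_ideal (alpha k.+1 a0 ^+ e.+1 - alpha k.+1 a0 * lift_flats (alpha k a0 ^+ e)).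
Proof.
elim: e => [|e IH]; first by rewrite expr0 [lift_flats 1]rmorph1 mulr1 subrr; apply: lincomb0.
rewrite exprS [alpha k a0 ^+ e.+1]exprS lift_flatsM.
have eA : lift_flats (alpha k a0) = alpha k.+1 a0 -
   \sum_(v : 'I_(nvar M') | (a0 \in vflat v) && (#|vflat v| == k)) 'X_v.
  by rewrite {2}/alpha (sum_flats_split (fun F => a0 \in F)) addrK.
have top := alpha_sum_top (fun F => a0 \in F).
have rearrange (x y z t : P') : x * y - x * ((x - t) * z) = x * (y - x * z) + z * (x * t) by ring.
by rewrite eA rearrange; apply: lincombD; apply: chow_idealM.
Qed.

(** The spanning monomials of rank [k + 1] in which [alpha] has exponent 0. *)
Definition top_normals d : seq P' :=
  [seq p.2 | p <- flatten [seq normal k.+1 F | F <- enum [set F : {set 'I_n} | #|F| < k.+1]%N] & p.1 == d].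

Lemma size_top_normals d : (size (normal_deg k.+1 a0 d.+1) = size (normal_deg k a0 d) + size (top_normals d.+1))%N.
Proof.
apply/eqP; rewrite -(eqr_nat int) natrD !size_normal_deg // chowHS coefD coefXM /=.
apply/eqP; congr (_ + _).
pose f t : {poly int} := der t.
transitivity (\sum_(F : {set 'I_n} | (F \subset setT) && (#|F| < k.+1)%N) f #|F|)`_d.+1.
  by rewrite sum_by_card cardsT card_ord.
have -> : \sum_(F : {set 'I_n} | (F \subset setT) && (#|F| < k.+1)%N) f #|F| =
  \sum_(p <- flatten [seq normal k.+1 F | F <- enum [set F : {set 'I_n} | #|F| < k.+1]%N]) 'X^(p.1).
  rewrite big_flatten big_map big_enum_cond /=; apply: eq_big => F; first by rewrite inE andbT subsetT.
  by rewrite gen_normal.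
rewrite coef_sum /top_normals size_map size_filter.
elim: flatten => [|p s IH]; first by rewrite big_nil.
by rewrite big_cons /= natrD IH coefXn eq_sym.
Qed.

(** Spanning monomials with a positive power of [alpha] come, modulo the ideal, from degree [d] in
    rank [k], so together they add at most [chow_dim M d] dimensions. *)
Lemma chow_dim_step d : (chow_dim M' d.+1 <= size (top_normals d.+1) + chow_dim M d)%N.
Proof.
pose C := (ideal_part M d)^C%VS.
pose f (w : 'rV[rat]_#|mons (nvar M) d|) := coefv d.+1 (alpha k.+1 a0 * lift_flats (polyv w)).
have f_lin : linear f.
  by move=> a u w; rewrite /f polyv_is_linear lift_flats_linear mulrDr -scalerAr coefv_is_linear.
pose U := <<map f (vbasis C)>>%VS.
have dimU : (\dim U <= chow_dim M d)%N.
  apply: leq_trans (dim_span _) _; rewrite size_map size_tuple /C.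
  by rewrite dimv_compl dimvf /dim /= mul1n leq_subLR addnC chow_dimE.
apply: leq_trans (_ : size (top_normals d.+1) + \dim U <= _)%N; last by rewrite leq_add2l.
apply: chow_dim_le => m md.
apply: lincomb_bind (normal_spanningX hkn a0 (ltn0Sn k) md) => b [bN|bI]; last first.
  by apply: lincomb_gen; constructor 3.
case/mapP: bN => -[d' b'] /=; rewrite mem_filter /= => /andP[/eqP -> /flattenP[r /mapP[F FE ->]]] + ->.
move: FE; rewrite mem_enum inE => Fk /allpairsP[[[du u] e] /= [uN eF [de ->]]].
move: eF de; rewrite mem_iota add0n => /andP[_ eF].
case: e eF => [|e] eF de.
  rewrite expr0 mul1r; apply: lincomb_gen; constructor 1.
  apply/mapP; exists (du, u) => //; rewrite mem_filter /= de add0n eqxx /=.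
  by apply/flattenP; exists (normal k.+1 F) => //; apply: map_f; rewrite mem_enum inE.
(* A positive exponent of [alpha] keeps the top flat below size [k], so the monomial is a lift. *)
have Fk' : (#|F| < k)%N by move: eF => /=; lia.
move: uN; rewrite lift_flats_normal // => /mapP[[du' u'] u'N /= [edu eu]]; subst du' u.
set q := alpha k a0 ^+ e * u'.
have qh : q \is d.-homog.
  have -> : d = (1 * e + du)%N by lia.
  by apply: dhomogM; [apply: dhomogMn; apply: sumX_homog|apply: normal_homog u'N].
have : coefv d q \in (ideal_part M d + C)%VS by rewrite addv_complf memvf.
case/memv_addP => w1 w1I [w2 w2C ew].
have eq : q = polyv w1 + polyv w2.
  by rewrite -(coefvK qh) ew -[w1 in LHS]scale1r polyv_is_linear scale1r.
have -> : alpha k.+1 a0 ^+ e.+1 * lift_flats u' =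
   (lift_flats u' * (alpha k.+1 a0 ^+ e.+1 - alpha k.+1 a0 * lift_flats (alpha k a0 ^+ e)) +
   alpha k.+1 a0 * lift_flats (polyv w1)) + alpha k.+1 a0 * lift_flats (polyv w2).
  rewrite -addrA -mulrDr -lift_flatsD -eq /q lift_flatsM.
  have rearrange (x y z t : P') : x * y = y * (x - z * t) + z * (t * y) by ring.
  exact: rearrange.
apply: lincombD; apply: lincomb_gen; [constructor 3|constructor 2].
  by apply: lincombD; [apply/chow_idealM/alpha_lift_exp|apply/alpha_lift_ideal/polyv_ideal].
rewrite -[coefv _ _]/(f w2); apply: span_map_linear => //.
by rewrite (span_basis (vbasisP _)).
Qed.

End Truncation.

Lemma chow_dim_unif k n d : (0 < k <= n)%N -> (chow_dim (unif k n) d)%:R = (chowH k n)`_d.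
Proof.
case: n => [|n]; first by lia.
move=> /andP[k0 kn]; rewrite -(size_normal_deg kn (ord0 : 'I_n.+1)); congr _%:R.
move: {2}(n.+1 - k)%N (erefl (n.+1 - k)%N) => c; elim: c k k0 kn d => [|c IH] k k0 kn d ek.
  have ->: k = n.+1 by lia.
  exact: chow_dim_boolean.
have kn' : (k < n.+1)%N by lia.
apply/eqP; rewrite eqn_leq chow_dim_le_normal //=.
have := chow_dim_step kn' (ord0 : 'I_n.+1) d; rewrite IH //; last by lia.
by rewrite (size_top_normals kn') addnC leq_add2l.
Qed.

(* Coefficientwise: [x^j] h_{Δ(L(U_{k,n}))}(x) = sum_{i=1}^k C(n-i-1,k-i) [x^j] H_{U_{i,n}}(x) *)
Theorem theoremA3 (k n : nat) (hk1 : (1 <= k)%N) (hkn : (k <= n)%N) (j : nat) :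
  (bergman_hpoly (unif k n))`_j =
  \sum_(1 <= i < k.+1)
     ((binomZ (n%:Z - i%:Z - 1) (k - i))%:R * (chow_dim (unif i n) j)%:R : int).
Proof.
rewrite bergman_chowH ?hk1 // coef_sum; apply: eq_big_nat => i ik.
rewrite chow_dim_unif; last by lia.
by rewrite mulr_natl coefMn mulr_natl.
Qed.
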